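(* Consider the setting, standing assumptions and BPGe iteration described in the context. Suppose $\rho<\underline{\lambda}/\overline{\lambda}$, let $M\in(\rho\,\underline{\lambda}^{-1},\overline{\lambda}^{-1}]$, and let $\{x^k\}_{k\in\mathbb{N}}$ be a sequence generated from $x^0$ by BPGe. Assume in addition that: (a) $h$ is $\sigma$-strongly convex on $\mathbb{R}^d$ for some $\sigma>0$; (b) $\nabla h$ and $\nabla f$ are Lipschitz continuous on every bounded subset of $\mathbb{R}^d$; (c) on every bounded subset $B$ of $\mathbb{R}^d$ the generalized derivative $\partial(\nabla h)$ admits bounded elements, i.e. there is $\delta>0$ such that for every $x\in B$ there exists $u\in\partial(\nabla h)(x)$ with $\|u\|\le\delta$; (d) the function $F:\mathbb{R}^{2d}\to(-\infty,+\infty]$, $F(x,y)=\Psi(x)+M D_h(y,x)$, has the Kurdyka--Łojasiewicz property (as defined in the context) at some limit point $\tilde z=(\tilde x,\tilde x)\in\mathbb{R}^{2d}$ of the sequence $\{(x^k,x^{k-1})\}_{k\in\mathbb{N}}$. Then: (i) the sequence $\{x^k\}_{k\in\mathbb{N}}$ has finite length, i.e. $\sum_{k=1}^{\infty}\|x^k-x^{k-1}\|<\infty$; (ii) $x^k\to\tilde x$ as $k\to\infty$, and $\tilde x$ is a critical point of $\Psi$.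
   Context: **Problem.** $\Psi=f+g$ on $\mathbb{R}^d$, where $f:\mathbb{R}^d\to\mathbb{R}$ is continuously differentiable (possibly nonconvex), $g:\mathbb{R}^d\to(-\infty,+\infty]$ is proper, lower semicontinuous and convex, and $\inf\Psi>-\infty$. **Kernel and Bregman distance.** $h\in\mathcal{G}(\mathbb{R}^d)$, i.e. $h$ is convex and $C^1$ on $\mathbb{R}^d$ (so $\operatorname{dom}h=\operatorname{int}\operatorname{dom}h=\mathbb{R}^d$). $D_h(x,y)=h(x)-h(y)-\langle\nabla h(y),x-y\rangle$. **Standing assumptions.** - $(f,h)$ is $L$-smooth adaptable: $L>0$ and both $Lh-f$ and $Lh+f$ are convex on $\mathbb{R}^d$. - $f$ is $\mu$-weakly convex relative to $h$: $f+\mu h$ is convex on $\mathbb{R}^d$, where $0\le\mu\le L$ ($\mu=0$ being used when $f$ is convex). - $\Psi$ is supercoercive: $\lim_{\|u\|\to\infty}\Psi(u)/\|u\|=\infty$. - $h$ is strictly convex; if $x^k\to x\in\operatorname{dom}h$ then $D_h(x,x^k)\to0$; if $y^k\to x^*$, $\{x^k\}$ is bounded and $D_h(x^k,y^k)\to0$, then $x^k\to x^*$ (here $\{x^k\},\{y^k\}$ are arbitrary sequences in $\operatorname{dom} h$). **BPGe.** Fix $0<\eta<1$, $\hat\beta\in[0,1)$, $0<\rho<1$, and step sizes $0<\lambda_k\le1/L$ ($k\in\mathbb{N}=\{0,1,2,\dots\}$) with $\underline{\lambda}:=\inf_k\lambda_k>0$, $\overline{\lambda}:=\sup_k\lambda_k$.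 Put $C_k=\lambda_k^{-1}/(\lambda_k^{-1}+\mu)$. Start from $x^{-1}=x^0\in\operatorname{int}\operatorname{dom}h=\mathbb{R}^d$. For $k=0,1,2,\dots$: let $\beta_k=\eta^j\hat\beta$ with $j\ge0$ the smallest integer such that $D_h(x^k,x^k+\eta^j\hat\beta(x^k-x^{k-1}))\le\rho\,C_k\,D_h(x^{k-1},x^k)$; set $y^k=x^k+\beta_k(x^k-x^{k-1})$ and choose $$x^{k+1}\in\arg\min_{x\in\mathbb{R}^d}\Big\{g(x)+\langle x-y^k,\nabla f(y^k)\rangle+\tfrac1{\lambda_k}D_h(x,y^k)\Big\}.$$ The iteration runs indefinitely (no stopping test). **Subdifferentials.** $\partial$ of an extended-real-valued function is the limiting (Mordukhovich) subdifferential; $\bar x$ is a critical point of $\Psi$ if $0\in\partial\Psi(\bar x)$. For the map $\nabla h$ (locally Lipschitz under (b)), $\partial(\nabla h)(x)$ is the Clarke generalized Jacobian. **Kurdyka--Łojasiewicz (KL) property.** A proper lower semicontinuous $F:\mathbb{R}^n\to(-\infty,+\infty]$ has the KL property at $\bar z\in\operatorname{dom}\partial F=\{z:\partial F(z)\ne\emptyset\}$ if there exist $\eta_0\in(0,+\infty]$, a neighborhood $U$ of $\bar z$ and a function $\psi:[0,\eta_0)\to\mathbb{R}_+$ with $\psi(0)=0$, $\psi$ continuous at $0$, $\psi\in C^1(0,\eta_0)$ and $\psi'>0$ on $(0,\eta_0)$, such that for all $z\in U$ with $F(\bar z)<F(z)<F(\bar z)+\eta_0$ one has $\psi'(F(z)-F(\bar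 z))\cdot\operatorname{dist}(0,\partial F(z))\ge1$. *)

(* Defs.v *)
From HB Require Import structures.
From mathcomp Require Import all_boot all_order all_algebra.
From mathcomp Require Import all_classical all_reals all_analysis.
Import numFieldNormedType.Exports.

Set Implicit Arguments.
Unset Strict Implicit.
Unset Printing Implicit Defensive.

Import Order.TTheory GRing.Theory Num.Theory.
Local Open Scope classical_set_scope.
Local Open Scope ring_scope.

(* R^n is 'rV[R]_n. The library norm on matrices is the max norm; dot and enorm
   are the Euclidean structure. The library notions used below (topology,
   differentiability, bounded_set, lipschitz) are insensitive to this choice. *)
Definition dot (R : realType) (n : nat) (u v : 'rV[R]_n) : R :=
  \sum_(i < n) u ord0 i * v ord0 i.

Definition enorm (R : realType) (n : nat) (u : 'rV[R]_n) : R :=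
  Num.sqrt (dot u u).

Definition grad (R : realType) (n : nat) (f : 'rV[R]_n -> R) (x : 'rV[R]_n) :
    'rV[R]_n :=
  \row_(i < n) 'D_(delta_mx ord0 i) f x.

Definition C1 (R : realType) (n : nat) (f : 'rV[R]_n -> R) : Prop :=
  (forall x, differentiable f x) /\ continuous (grad f).

Definition breg (R : realType) (n : nat) (h : 'rV[R]_n -> R)
    (x y : 'rV[R]_n) : R :=
  h x - h y - dot (grad h y) (x - y).

Definition strictly_convex (R : realType) (n : nat) (h : 'rV[R]_n -> R) : Prop :=
  forall (x y : 'rV[R]_n) (t : R), x != y -> 0 < t -> t < 1 ->
    h (t *: x + (1 - t) *: y) < t * h x + (1 - t) * h y.

Definition strongly_convex (R : realType) (n : nat) (sigma : R)
    (h : 'rV[R]_n -> R) : Prop :=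
  forall (x y : 'rV[R]_n) (t : R), 0 <= t -> t <= 1 ->
    h (t *: x + (1 - t) *: y) <=
      t * h x + (1 - t) * h y - sigma / 2 * t * (1 - t) * enorm (x - y) ^+ 2.

Section ExtendedRealValued.
Local Open Scope ereal_scope.

Definition eproper (R : realType) (n : nat) (g : 'rV[R]_n -> \bar R) : Prop :=
  (forall x, -oo < g x) /\ (exists x, g x < +oo).

Definition econvex (R : realType) (n : nat) (g : 'rV[R]_n -> \bar R) : Prop :=
  forall (x y : 'rV[R]_n) (t : R), (0 < t)%R -> (t < 1)%R ->
    g (t *: x + (1 - t) *: y)%R <= t%:E * g x + (1 - t)%:E * g y.

Definition supercoercive (R : realType) (n : nat) (F : 'rV[R]_n -> \bar R) :
    Prop :=
  forall A : R, exists r : R, (0 < r)%R /\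
    forall u, (r < enorm u)%R -> A%:E <= F u * ((enorm u)^-1)%:E.

(* Regular (Frechet) subgradients: F y >= F x + <v, y - x> + o(|y - x|). *)
Definition frechet_subdiff (R : realType) (n : nat) (F : 'rV[R]_n -> \bar R)
    (x : 'rV[R]_n) : set 'rV[R]_n :=
  [set v | F x \is a fin_num /\
     forall e : R, (0 < e)%R -> \forall y \near x,
       F x + (dot v (y - x) - e * enorm (y - x))%:E <= F y].

Definition lim_subdiff (R : realType) (n : nat) (F : 'rV[R]_n -> \bar R)
    (x : 'rV[R]_n) : set 'rV[R]_n :=
  [set v | F x \is a fin_num /\
     exists (xs vs : nat -> 'rV[R]_n),
       [/\ xs @ \oo --> x, F (xs k) @[k --> \oo] --> F x,
           forall k, frechet_subdiff F (xs k) (vs k) & vs @ \oo --> v]].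

Definition critical (R : realType) (n : nat) (F : 'rV[R]_n -> \bar R)
    (x : 'rV[R]_n) : Prop :=
  lim_subdiff F x 0%R.

(* +oo when A is empty *)
Definition edist0 (R : realType) (n : nat) (A : set 'rV[R]_n) : \bar R :=
  ereal_inf [set (enorm v)%:E | v in A].

(* psi is total, but only its restriction to [0, eta0[ matters. *)
Definition desingularizing (R : realType) (eta0 : \bar R) (psi : R -> R) :
    Prop :=
  [/\ psi 0%R = 0%R,
      forall s : R, (0 <= s)%R -> s%:E < eta0 -> (0 <= psi s)%R,
      psi @ (0%R : R)^'+ --> psi 0%R &
      forall s : R, (0 < s)%R -> s%:E < eta0 ->
        [/\ derivable psi s 1%R, {for s, continuous (derive1 psi)} &
            (0 < derive1 psi s)%R]].

Definition KL_at (R : realType) (n : nat) (F : 'rV[R]_n -> \bar R)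
    (zb : 'rV[R]_n) : Prop :=
  lim_subdiff F zb !=set0 /\
  exists (eta0 : \bar R) (U : set 'rV[R]_n) (psi : R -> R),
    [/\ 0 < eta0, nbhs zb U, desingularizing eta0 psi &
        forall z, U z -> F zb < F z -> F z < F zb + eta0 ->
          1 <= (derive1 psi (fine (F z - F zb)))%:E * edist0 (lim_subdiff F z)].

Definition Psi (R : realType) (d : nat) (f : 'rV[R]_d -> R)
    (g : 'rV[R]_d -> \bar R) (x : 'rV[R]_d) : \bar R :=
  (f x)%:E + g x.

(* R^{2d} is 'rV[R]_(d + d), the pair (x, y) being row_mx x y. *)
Definition merit (R : realType) (d : nat) (f h : 'rV[R]_d -> R)
    (g : 'rV[R]_d -> \bar R) (M : R) (z : 'rV[R]_(d + d)) : \bar R :=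
  Psi f g (lsubmx z) + (M * breg h (rsubmx z) (lsubmx z))%:E.

Definition bpg_model (R : realType) (d : nat) (f h : 'rV[R]_d -> R)
    (g : 'rV[R]_d -> \bar R) (lam : R) (y x : 'rV[R]_d) : \bar R :=
  g x + (dot (x - y) (grad f y) + lam^-1 * breg h x y)%:E.

End ExtendedRealValued.

Definition opnorm (R : realType) (n m : nat) (A : 'M[R]_(n, m)) : R :=
  sup [set enorm (v *m A) | v in [set v : 'rV[R]_n | enorm v <= 1]].

(* Clarke generalized Jacobian: convex hull of the limits of Jacobians at
   neighbouring points of differentiability. The library Jacobian acts on row
   vectors, so it is the transpose of the usual one; opnorm is the same. *)
Definition clarke_jacobian (R : realType) (n m : nat)
    (G : 'rV[R]_n -> 'rV[R]_m) (x : 'rV[R]_n) : set 'M[R]_(n, m) :=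
  let B := [set J : 'M[R]_(n, m) | exists u : nat -> 'rV[R]_n,
    [/\ forall k, differentiable G (u k), u @ \oo --> x &
        jacobian G (u k) @[k --> \oo] --> J]] in
  [set A | exists (p : nat) (w : 'I_p -> R) (J : 'I_p -> 'M[R]_(n, m)),
    [/\ forall i, 0 <= w i, \sum_(i < p) w i = 1, forall i, B (J i) &
        A = \sum_(i < p) w i *: J i]].

Definition extrapolate (R : realType) (d : nat) (x : nat -> 'rV[R]_d) (k : nat)
    (t : R) : 'rV[R]_d :=
  x k + t *: (x k - x k.-1).

Definition linesearch_ok (R : realType) (d : nat) (h : 'rV[R]_d -> R)
    (mu rho lamk : R) (x : nat -> 'rV[R]_d) (k : nat) (t : R) : Prop :=
  breg h (x k) (extrapolate x k t) <=
    rho * (lamk^-1 / (lamk^-1 + mu)) * breg h (x k.-1) (x k).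

(* x^{k-1} is x k.-1: as 0.-1 = 0, this is the convention x^{-1} = x^0. *)
Definition is_BPGe (R : realType) (d : nat) (f h : 'rV[R]_d -> R)
    (g : 'rV[R]_d -> \bar R) (mu eta betahat rho : R) (lam : nat -> R)
    (x : nat -> 'rV[R]_d) : Prop :=
  forall k : nat, exists j : nat,
    [/\ linesearch_ok h mu rho (lam k) x k (eta ^+ j * betahat),
        forall i : nat, (i < j)%N ->
          ~ linesearch_ok h mu rho (lam k) x k (eta ^+ i * betahat) &
        let y := extrapolate x k (eta ^+ j * betahat) in
        forall u : 'rV[R]_d,
          (bpg_model f h g (lam k) y (x k.+1) <= bpg_model f h g (lam k) y u)%E].

(* Main.v *)
(* The values E k of the merit function F at (x k.+1, x k) decrease by at least a
   multiple of |x k.+1 - x k|^2, and the optimality condition of a step bounds the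
   slope of F at these points by the last two step lengths.

   F contains <grad h x, y - x> with grad h merely Lipschitz, so no subgradient of
   F is computed: from a local lower bound F z >= F z0 - A |z - z0| - C |z - z0|^2,
   minimising F + K |. - z0|^2 for large K yields points near z0 with a regular
   subgradient of norm at most 4 A, and the KL inequality passes to z0 by
   continuity of F along these points and of psi'.

   The desingularizing function psi is not assumed concave, so
   psi (E k - b) - psi (E k.+1 - b) cannot be bounded below through psi' (E k - b).
   The mean value theorem gives psi' at an intermediate level s; moving only the
   second variable of F away from x k.+2 produces a point at level s exactly,
   whose slope is still controlled by the step lengths.

   With S k = sqrt (E k - E k.+1) this gives
   (S k)^2 <= c (psi_k - psi_{k+1}) (S k + S k.+1) as long as the iterates are close
   to xt; summing traps them there and makes the sum of the S k finite. *)

Require Import Defs.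
From HB Require Import structures.
From mathcomp Require Import all_boot all_order all_algebra.
From mathcomp Require Import all_classical all_reals all_analysis.
From mathcomp Require Import ring lra.
Import numFieldNormedType.Exports.

Set Implicit Arguments.
Unset Strict Implicit.
Unset Printing Implicit Defensive.

Import Order.TTheory GRing.Theory Num.Theory.
Local Open Scope classical_set_scope.
Local Open Scope ring_scope.

(** * Euclidean geometry and gradients *)

Section Euclidean.
Variables (R : realType) (n : nat).
Implicit Types (u v w : 'rV[R]_n) (c : R).

Lemma dotC u v : dot u v = dot v u.
Proof. by apply: eq_bigr => i _; rewrite mulrC. Qed.

Lemma dotDl u v w : dot (u + v) w = dot u w + dot v w.
Proof. by rewrite -big_split; apply: eq_bigr => i _; rewrite mxE mulrDl. Qed.

Lemma dotZl c u v : dot (c *: u) v = c * dot u v.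
Proof. by rewrite mulr_sumr; apply: eq_bigr => i _; rewrite mxE mulrA. Qed.

Lemma dotNl u v : dot (- u) v = - dot u v.
Proof. by rewrite -scaleN1r dotZl mulN1r. Qed.

Lemma dotBl u v w : dot (u - v) w = dot u w - dot v w.
Proof. by rewrite dotDl dotNl. Qed.

Lemma dotDr u v w : dot u (v + w) = dot u v + dot u w.
Proof. by rewrite dotC dotDl !(dotC u). Qed.

Lemma dotZr c u v : dot u (c *: v) = c * dot u v.
Proof. by rewrite dotC dotZl dotC. Qed.

Lemma dotNr u v : dot u (- v) = - dot u v.
Proof. by rewrite dotC dotNl dotC. Qed.

Lemma dotBr u v w : dot u (v - w) = dot u v - dot u w.
Proof. by rewrite dotDr dotNr. Qed.

Definition dotE := (dotBl, dotBr, dotDl, dotDr, dotNl, dotNr, dotZl, dotZr).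

Lemma dot0r u : dot u 0 = 0.
Proof. by rewrite -(scale0r u) dotZr mul0r. Qed.

Lemma dot_ge0 u : 0 <= dot u u.
Proof. by apply: sumr_ge0 => i _; rewrite -expr2 sqr_ge0. Qed.

Lemma enorm_ge0 u : 0 <= enorm u.
Proof. exact: sqrtr_ge0. Qed.

Lemma sqr_enorm u : enorm u ^+ 2 = dot u u.
Proof. by rewrite sqr_sqrtr ?dot_ge0. Qed.

Lemma enormZ c u : enorm (c *: u) = `|c| * enorm u.
Proof. by rewrite /enorm dotZl dotZr mulrA -expr2 sqrtrM ?sqr_ge0 ?sqrtr_sqr. Qed.

Lemma enormN u : enorm (- u) = enorm u.
Proof. by rewrite -scaleN1r enormZ normrN1 mul1r. Qed.

Lemma enormB u v : enorm (u - v) = enorm (v - u).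
Proof. by rewrite -enormN opprB. Qed.

Lemma enorm0 : enorm (0 : 'rV[R]_n) = 0.
Proof. by rewrite /enorm dot0r sqrtr0. Qed.

Lemma norm_le_enorm u : `|u| <= enorm u.
Proof.
rewrite (_ : `|u| = mx_norm u) // mx_normrE; apply: bigmax_le; first exact: enorm_ge0.
move=> [i j] _; rewrite (ord1 i) -sqrtr_sqr ler_wsqrtr // /dot (bigD1 j) //=.
by rewrite -expr2 lerDl sumr_ge0 // => k _; rewrite -expr2 sqr_ge0.
Qed.

Lemma enorm_eq0 u : enorm u = 0 -> u = 0.
Proof. by move=> u0; apply/normr0_eq0/le_anti; rewrite normr_ge0 -u0 norm_le_enorm. Qed.

(** Cauchy-Schwarz, from [0 <= |q u - p v|^2 = 2 p q (p q - dot u v)] with [p = enorm u] and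
    [q = enorm v]. *)
Lemma dot_le_enorm u v : dot u v <= enorm u * enorm v.
Proof.
have [/enorm_eq0 ->|v0] := eqVneq (enorm v) 0.
  by rewrite dot0r mulr_ge0 ?enorm_ge0.
have [/enorm_eq0 ->|u0] := eqVneq (enorm u) 0.
  by rewrite dotC dot0r mulr_ge0 ?enorm_ge0.
have v_gt0 : 0 < enorm v by rewrite lt_def v0 enorm_ge0.
have u_gt0 : 0 < enorm u by rewrite lt_def u0 enorm_ge0.
have := dot_ge0 (enorm v *: u - enorm u *: v).
rewrite !dotE -!sqr_enorm (dotC v u) => H.
rewrite -(ler_pM2l (mulr_gt0 u_gt0 v_gt0)).
by move: H; set p := enorm u; set q := enorm v; nra.
Qed.

Lemma dot_ge_enorm u v : - (enorm u * enorm v) <= dot u v.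
Proof. by rewrite lerNl -dotNl -(enormN u) dot_le_enorm. Qed.

Lemma enormD u v : enorm (u + v) <= enorm u + enorm v.
Proof.
rewrite -(@ler_pXn2r _ 2) ?nnegrE ?addr_ge0 ?enorm_ge0 //.
rewrite sqr_enorm sqrrD !sqr_enorm !dotE (dotC v u).
by have := dot_le_enorm u v; lra.
Qed.

Lemma enorm_triangle u v w : enorm (u - w) <= enorm (u - v) + enorm (v - w).
Proof. by rewrite (le_trans _ (enormD _ _)) // addrA subrK. Qed.

Lemma enorm_le_norm u : enorm u <= n%:R * `|u|.
Proof.
rewrite -(@ler_pXn2r _ 2) ?nnegrE ?mulr_ge0 ?enorm_ge0 // sqr_enorm.
apply: (@le_trans _ _ (\sum_(i < n) `|u| ^+ 2)).
  apply: ler_sum => i _; rewrite -expr2 -real_normK ?num_real //.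
  rewrite ler_pXn2r ?nnegrE // (_ : `|u| = mx_norm u) // mx_normrE.
  exact: (le_bigmax _ (fun ij => `|u ij.1 ij.2|) (ord0, i)).
rewrite sumr_const card_ord -[in leLHS]mulr_natl exprMn ler_wpM2r ?sqr_ge0 //.
by rewrite -natrX ler_nat; case: (n) => // k; rewrite leq_pmulr.
Qed.

End Euclidean.

(** * Euclidean balls and the topology of the max norm *)

Section EuclideanTopology.
Variables (R : realType) (n : nat).
Implicit Types (u v w x : 'rV[R]_n).

Lemma nbhs_enormP x (A : set 'rV[R]_n) :
  nbhs x A <-> exists2 e : R, 0 < e & forall y, enorm (y - x) < e -> A y.
Proof.
split=> [/nbhs_ballP[e /= e0 xA]|[e e0 xA]].
  exists e => // y yx; apply: xA; rewrite -ball_normE /=.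
  by rewrite (le_lt_trans _ yx) // distrC norm_le_enorm.
(* [n.+1] instead of [n] keeps the radius positive when [n = 0]. *)
apply/nbhs_ballP; exists (e / n.+1%:R) => /=; first by rewrite divr_gt0.
move=> y; rewrite -ball_normE /= distrC ltr_pdivlMr // => yx; apply: xA.
rewrite (le_lt_trans (enorm_le_norm (y - x))) // (le_lt_trans _ yx) // mulrC.
by rewrite ler_wpM2l // ler_nat.
Qed.

Lemma near_enorm x (e : R) : 0 < e -> \forall y \near x, enorm (y - x) < e.
Proof. by move=> e0; apply/nbhs_enormP; exists e. Qed.

Lemma cvg_enorm (u : nat -> 'rV[R]_n) x :
  (forall e : R, 0 < e -> \forall k \near \oo, enorm (u k - x) < e) ->
  u @ \oo --> x.
Proof.
move=> H A /nbhs_enormP[e e0 eA]; apply: filterS (H e e0) => k; exact: eA.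
Qed.

Lemma bounded_enorm (A : set 'rV[R]_n) (r : R) :
  (forall x, A x -> enorm x <= r) -> bounded_set A.
Proof.
move=> Ar; exists r; split; first exact: num_real.
by move=> q rq x /Ar xr /=; rewrite (le_trans (norm_le_enorm x)) // (le_trans xr) // ltW.
Qed.

Lemma lipschitz_enorm (G : 'rV[R]_n -> 'rV[R]_n) (r : R) :
  (forall B : set 'rV[R]_n, bounded_set B -> [lipschitz G u | u in B]) ->
  exists2 l : R, 0 <= l & forall u v, enorm u <= r -> enorm v <= r ->
    enorm (G u - G v) <= l * enorm (u - v).
Proof.
move=> /(_ [set u | enorm u <= r]) [|q [_ qP]].
  have := @bounded_enorm [set u | enorm u <= r] r (fun x xr => xr).
  exact.
(* Every constant above [q] is a Lipschitz constant; this one is also nonnegative. *)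
have /qP H : q < Num.max q 0 + 1.
  by rewrite (@le_lt_trans _ _ (Num.max q 0)) ?ltrDl // le_max lexx.
exists (n%:R * (Num.max q 0 + 1)) => [|u v ur vr].
  by rewrite mulr_ge0 // addr_ge0 // le_max lexx orbT.
have := H (u, v) (conj ur vr) => /= {}H.
rewrite (le_trans (enorm_le_norm _)) // -mulrA ler_wpM2l // (le_trans H) //.
by rewrite ler_wpM2l ?norm_le_enorm // addr_ge0 // le_max lexx orbT.
Qed.

End EuclideanTopology.

(** * Gradients, convexity and Bregman distances *)

Section Gradient.
Variables (R : realType) (n : nat).
Implicit Types (phi h f : 'rV[R]_n -> R) (u v x y : 'rV[R]_n).

Lemma derive_grad phi x v : differentiable phi x -> 'D_v phi x = dot (grad phi x) v.
Proof.
move=> dphi; rewrite deriveE // [in LHS](row_sum_delta v) linear_sum.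
by apply: eq_bigr => i _; rewrite linearZ /= mxE deriveE // mulrC.
Qed.

Lemma gradD phi f (a b : R) x : differentiable phi x -> differentiable f x ->
  grad (fun u => a * phi u + b * f u) x = a *: grad phi x + b *: grad f x.
Proof.
move=> dphi df; apply/rowP => i; rewrite !mxE.
have dp : derivable phi x (delta_mx ord0 i) by exact: diff_derivable.
have df' : derivable f x (delta_mx ord0 i) by exact: diff_derivable.
rewrite (_ : (fun u => _) = (a \*: phi) + (b \*: f)) //.
rewrite deriveD; [|exact: derivableZ|exact: derivableZ].
by rewrite (deriveZ a dp) (deriveZ b df').
Qed.

(* Both signs of [c] occur: convexity bounds slopes from above, the optimality of
   a step from below. *)
Lemma grad_le_slope phi x v (c A B : R) : differentiable phi x ->
  (forall t : R, 0 < t -> t < 1 -> c * (phi (x + t *: v) - phi x) <= t * A + t ^+ 2 * B) ->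
  c * dot (grad phi x) v <= A.
Proof.
move=> dphi H; rewrite -derive_grad //.
have D : (fun t : R => c * (t^-1 * (phi (x + t *: v) - phi x))) @ 0^'+
    --> c * 'D_v phi x.
  apply: cvgMr; apply: cvg_dnbhs_at_right.
  rewrite (_ : (fun t => _) = fun t => t^-1 *: ((phi \o shift x) (t *: v) - phi x)).
    exact: (@diff_derivable _ _ _ phi x v dphi).
  by apply/funext => t; rewrite /= (addrC x).
have E : (fun t : R => A + t * B) @ 0^'+ --> A.
  apply: cvg_at_right_filter; rewrite -[X in _ --> X]addr0 -[X in _ --> _ + X](mul0r B).
  by apply: cvgD; [exact: cvg_cst|apply: cvgMl; exact: cvg_id].
apply: (ler_cvg_to D E); near=> t.
have t0 : 0 < t by near: t; exact: nbhs_right_gt.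
have t1 : t < 1 by near: t; exact: nbhs_right_lt.
rewrite mulrCA -(ler_pM2l t0) mulVKf ?gt_eqF //.
by rewrite (le_trans (H t t0 t1)) // mulrDr expr2 mulrA.
Unshelve. all: by end_near. Qed.

Lemma convex_functionP phi : convex_function setT (phi : _ -> R^o) ->
  forall x y (t : R), 0 <= t -> t <= 1 ->
  phi (t *: x + (1 - t) *: y) <= t * phi x + (1 - t) * phi y.
Proof.
move=> cphi x y t t0 t1.
by have := cphi (@Itv01 R t t0 t1) x y (in_setT _) (in_setT _); rewrite convRE.
Qed.

Lemma convex_grad_le phi x y : differentiable phi x ->
  convex_function setT (phi : _ -> R^o) ->
  phi x + dot (grad phi x) (y - x) <= phi y.
Proof.
move=> dphi /convex_functionP cphi; rewrite addrC -lerBrDr.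
have := @grad_le_slope phi x (y - x) 1 (phi y - phi x) 0 dphi.
rewrite mul1r; apply=> t t0 t1; rewrite mul1r mulr0 addr0.
rewrite (_ : x + t *: (y - x) = t *: y + (1 - t) *: x).
  by have := cphi y x t (ltW t0) (ltW t1); lra.
by apply/rowP => i; rewrite !mxE; ring.
Qed.

Lemma breg_ge0 h u v : differentiable h v ->
  convex_function setT (h : _ -> R^o) -> 0 <= breg h u v.
Proof. by move=> dh /(convex_grad_le u dh); rewrite /breg; lra. Qed.

(** The right side minus the left side is [breg h v u], which is nonnegative. *)
Lemma breg_le_dot h u v : differentiable h u ->
  convex_function setT (h : _ -> R^o) ->
  breg h u v <= dot (grad h u - grad h v) (u - v).
Proof.
move=> dh /(convex_grad_le v dh); rewrite /breg -opprB dotNr dotBl; lra.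
Qed.

(** Along the segment from [v] to [u], the strong convexity inequality bounds the increment of [h]
    by a linear term in [t] plus a multiple of [t ^+ 2], which is lost in the limit of the slopes at
    [v]. *)
Lemma strongly_convex_breg (sigma : R) h u v : differentiable h v ->
  strongly_convex sigma h -> sigma / 2 * enorm (u - v) ^+ 2 <= breg h u v.
Proof.
move=> dh ch; rewrite /breg.
have := @grad_le_slope h v (u - v) 1 (h u - h v - sigma / 2 * enorm (u - v) ^+ 2)
  (sigma / 2 * enorm (u - v) ^+ 2) dh.
rewrite mul1r => H.
suff : dot (grad h v) (u - v) <= h u - h v - sigma / 2 * enorm (u - v) ^+ 2 by lra.
apply: H => t t0 t1; rewrite mul1r.
rewrite (_ : v + t *: (u - v) = t *: u + (1 - t) *: v).
  by have := ch u v t (ltW t0) (ltW t1); lra.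
by apply/rowP => i; rewrite !mxE; ring.
Qed.

Lemma breg_three_point h u v w :
  breg h u w = breg h u v + breg h v w + dot (grad h v - grad h w) (u - v).
Proof.
rewrite /breg (_ : u - w = (u - v) + (v - w)); last by rewrite addrA subrK.
by rewrite !dotE; ring.
Qed.

Lemma breg_self h u : breg h u u = 0.
Proof. by rewrite /breg !subrr dot0r subr0. Qed.

End Gradient.

(** * Slopes and the Kurdyka-Lojasiewicz inequality *)

Section Semicontinuity.
Variables (R : realType) (n : nat).
Implicit Types (F : 'rV[R]_n -> \bar R) (phi : 'rV[R]_n -> R) (x y z v : 'rV[R]_n).

Lemma continuous_enorm_dist z : continuous (fun x => enorm (x - z)).
Proof.
move=> x A /nbhs_ballP[e /= e0 eA]; apply/nbhs_enormP; exists e => // y yx.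
apply: eA; rewrite -ball_normE /=.
have h1 := enorm_triangle x y z; have h2 := enorm_triangle y x z.
rewrite (enormB x y) in h1.
by rewrite (le_lt_trans _ yx) // ler_norml; apply/andP; split; lra.
Qed.

Lemma lower_semicontinuousD F phi : lower_semicontinuous F -> continuous phi ->
  lower_semicontinuous (fun x => F x + (phi x)%:E)%E.
Proof.
move=> lF cphi x a ax.
have [e e0 He] : exists2 e : R, 0 < e & ((a - phi x + e)%:E < F x)%E.
  move: ax; case: (F x) => [r||] //=; last by exists 1 => //; rewrite ltry.
  rewrite -EFinD lte_fin => ax; exists ((phi x + r - a) / 2); first lra.
  by rewrite lte_fin; lra.
have [V xV VF] := lF _ _ He.
have /cvgrPdist_lt/(_ _ e0) := cphi x => xe.
exists (V `&` [set y | `|phi x - phi y| < e]); first exact: filterI.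
move=> y [Vy /=]; rewrite ltr_norml => /andP[y1 y2].
move: (VF y Vy); case: (F y) => [r||] //=; last by rewrite addye ?ltry.
by rewrite -EFinD !lte_fin; lra.
Qed.

(** Weierstrass: the sublevel sets of [F] at the points of [K] are nested, so they generate a proper
    filter on [K]. A cluster point of it is a minimiser, for otherwise a real level strictly below
    its value would be exceeded on a whole neighbourhood. *)
Lemma lower_semicontinuous_min F (K : set 'rV[R]_n) :
  lower_semicontinuous F -> (forall x, -oo < F x)%E -> compact K -> K !=set0 ->
  exists2 z, K z & forall y, K y -> (F z <= F y)%E.
Proof.
move=> lF F_gt cK [k0 Kk0].
pose G := filter_from K (fun y => K `&` [set z | (F z <= F y)%E]).
have GF : ProperFilter G.
  apply: filter_from_proper; last by move=> y Ky; exists y; split => /=.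
  apply: filter_from_filter; first by exists k0.
  move=> y z Ky Kz; case: (leP (F y) (F z)) => yz.
    by exists y => // w [Kw wy]; split; split=> //=; exact: le_trans yz.
  by exists z => // w [Kw wz]; split; split=> //=; exact: le_trans (ltW yz).
have [|z [Kz clz]] := cK G GF; first by exists k0 => // w [].
exists z => // y Ky; rewrite leNgt; apply/negP => yz.
have [a ya az] : exists2 a : R, (F y <= a%:E)%E & (a%:E < F z)%E.
  move: yz (F_gt y); case: (F y) => [r||] // yz _; first by exists r.
  by rewrite ltNge leey in yz.
have [V zV VF] := lF _ _ az.
have [w [[Kw wy] Vw]] := clz _ V (ex_intro2 _ _ y Ky (fun w h => h)) zV.
by have := VF w Vw; rewrite ltNge (le_trans wy ya).
Qed.

End Semicontinuity.

Section Slope.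
Variables (R : realType) (n : nat).
Implicit Types (F : 'rV[R]_n -> \bar R) (x y z v : 'rV[R]_n).

(** A quadratic error is [o(|y - z|)]: it is at most [e * |y - z|] within distance
    [e / (|K| + 1)]. *)
Lemma frechet_subdiff_quadratic F z v (r K delta : R) : F z = r%:E -> 0 < delta ->
  (forall y, enorm (y - z) < delta ->
    ((r + dot v (y - z) - K * enorm (y - z) ^+ 2)%:E <= F y)%E) ->
  frechet_subdiff F z v.
Proof.
move=> Fz d0 H; split; first by rewrite Fz.
move=> e e0; rewrite Fz.
have e'0 : 0 < e / (`|K| + 1) by rewrite divr_gt0 ?ltr_wpDl.
apply: filterS2 (near_enorm z d0) (near_enorm z e'0) => y /H yH.
rewrite ltr_pdivlMr ?ltr_wpDl // => ye; apply: le_trans yH.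
rewrite -EFinD lee_fin; have := ler_norm K; have := enorm_ge0 (y - z).
by set s := enorm _ in ye *; nra.
Qed.

Lemma frechet_lim_subdiff F z v : frechet_subdiff F z v -> lim_subdiff F z v.
Proof.
move=> zv; split; first by case: zv.
by exists (fun=> z), (fun=> v); split=> //; exact: cvg_cst.
Qed.

(* [z] minimises [F + K * |. - z0|^2] near [z0] for a large [K]: the growth
   hypothesis forces [K * |z - z0|] to be at most [2 * A]. *)
Lemma small_subgradient F z0 (a A C delta e : R) :
  lower_semicontinuous F -> (forall x, -oo < F x)%E -> F z0 = a%:E ->
  0 <= A -> 0 <= C -> 0 < delta ->
  (forall y, enorm (y - z0) <= delta ->
    ((a - A * enorm (y - z0) - C * enorm (y - z0) ^+ 2)%:E <= F y)%E) ->
  0 < e -> exists z v (b : R), [/\ frechet_subdiff F z v, enorm v <= 4 * A,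
    enorm (z - z0) < e, F z = b%:E & a - e <= b <= a].
Proof.
move=> lF F_gt Fz0 A0 C0 d0 low e0.
have [q [q0 q1 qd qe qe']] :
    exists q : R, [/\ 0 < q, q <= 1, q <= delta, q <= e & A * q + C * q <= e].
  have AC : 0 < A + C + 1 by lra.
  exists (Num.min (Num.min 1 delta) (Num.min e (e / (A + C + 1)))).
  split; rewrite ?lt_min ?ge_min ?ltr01 ?d0 ?e0 ?divr_gt0 ?lexx ?orbT //.
  set q := Num.min _ _; have : q <= e / (A + C + 1) by rewrite !ge_min lexx !orbT.
  rewrite ler_pdivlMr //; have : 0 < q by rewrite !lt_min ltr01 d0 e0 divr_gt0.
  by nra.
(* For [s = |z - z0|], minimality and the growth bound give [(K - C) * s <= A]. Since
   [(K - C) * q >= A + 1], this forces [s < q]; since [K > 2 * C], it also gives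
   [2 * K * s <= 4 * A]. *)
pose K := 2 * C + (A + 1) / q.
have Kq : (K - 2 * C) * q = A + 1 by rewrite /K addrC addKr divfK ?gt_eqF.
have K0 : 0 < K - 2 * C by rewrite -(pmulr_lgt0 _ q0) Kq; lra.
clearbody K.
have K_gt0 : 0 < K by lra.
pose B := [set z : 'rV[R]_n | enorm (z - z0) <= delta].
have cont_dist := @continuous_enorm_dist R n z0.
have cB : compact B.
  apply: bounded_closed_compact.
    have := @bounded_enorm _ _ B (delta + enorm z0).
    apply=> z /= zB; have := enormD (z - z0) z0; rewrite subrK /B /= in zB *; lra.
  apply: (@closed_comp _ _ (fun z => enorm (z - z0)) [set t | t <= delta]).
    by move=> z _; exact: cont_dist.
  exact: closed_le.
have lG : lower_semicontinuous (fun z => F z + (K * enorm (z - z0) ^+ 2)%:E)%E.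
  apply: lower_semicontinuousD => // z.
  apply: (@continuous_comp _ _ _ (fun z => enorm (z - z0)) (fun t => K * t ^+ 2)).
    exact: cont_dist.
  by apply: cvgMr; exact: exprn_continuous.
have Bz0 : B z0 by rewrite /B /= subrr enorm0 ltW.
have [|z Bz zmin] := lower_semicontinuous_min lG _ cB (ex_intro _ z0 Bz0).
  by move=> y; have := F_gt y; case: (F y) => [r||] //= _; rewrite ?ltNyr ?addye.
have [b Fz] : exists b : R, F z = b%:E.
  have := zmin _ Bz0; rewrite Fz0; have := F_gt z.
  by case: (F z) => [b||] //= _ _; exists b.
have := zmin _ Bz0; rewrite Fz0 Fz subrr enorm0 expr0n mulr0 addr0 -EFinD lee_fin.
have := low z Bz; rewrite Fz lee_fin.
set s := enorm (z - z0) => lowz minz.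
have s0 : 0 <= s by exact: enorm_ge0.
have sA : (K - C) * s <= A.
  have [->|sn] := eqVneq s 0; first by rewrite mulr0.
  by rewrite -(ler_pM2r (_ : 0 < s)) ?lt_def ?sn //; nra.
have sq : s < q by rewrite -(ltr_pM2l (_ : 0 < K - C)); nra.
(* The subgradient is minus the gradient at [z] of the penalty [K * |. - z0|^2]; the ball of radius
   [delta - s] about [z] stays inside [B]. *)
exists z, (- (2 * K) *: (z - z0)), b; split => //.
- apply: (@frechet_subdiff_quadratic _ _ _ b K (delta - s)) => //; first by lra.
  move=> y ys.
  have ty := enorm_triangle y z z0.
  have By : B y by rewrite /B /=; rewrite -/s in ty; lra.
  have := zmin y By; rewrite Fz.
  have -> : enorm (y - z0) ^+ 2 = s ^+ 2 + 2 * dot (z - z0) (y - z) + enorm (y - z) ^+ 2.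
    rewrite /s !sqr_enorm (_ : y - z0 = (z - z0) + (y - z)).
      by move: (z - z0) (y - z) => p w; rewrite !dotE (dotC w p); ring.
    by rewrite [RHS]addrC addrA subrK.
  case: (F y) (F_gt y) => [r _|_ _|//]; last exact: leey.
  by rewrite -/s -!EFinD !lee_fin dotZl; lra.
- rewrite enormZ normrN gtr0_norm ?mulr_gt0 // -/s.
  by nra.
- exact: lt_le_trans sq qe.
- by apply/andP; split; nra.
Qed.

(** If the conclusion failed, continuity of [psi'] would make it fail at all levels near [a - b].
    But [small_subgradient] yields a point of [U] at such a level having a subgradient of norm at
    most [4 * A], against the KL inequality there. *)
Lemma KL_slope F zb z0 (eta0 : \bar R) U psi (a b A C delta : R) :
  lower_semicontinuous F -> (forall x, -oo < F x)%E ->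
  desingularizing eta0 psi ->
  (forall z, U z -> F zb < F z -> F z < F zb + eta0 ->
    1 <= (derive1 psi (fine (F z - F zb)))%:E * edist0 (lim_subdiff F z))%E ->
  nbhs z0 U -> F zb = b%:E -> F z0 = a%:E -> b < a -> ((a - b)%:E < eta0)%E ->
  0 <= A -> 0 <= C -> 0 < delta ->
  (forall y, enorm (y - z0) <= delta ->
    ((a - A * enorm (y - z0) - C * enorm (y - z0) ^+ 2)%:E <= F y)%E) ->
  1 <= derive1 psi (a - b) * (4 * A).
Proof.
move=> lF F_gt [_ _ _ psiP] KL z0U Fzb Fz0 ba aeta A0 C0 d0 low.
rewrite leNgt; apply/negP => lt1.
have ab0 : 0 < a - b by rewrite subr_gt0.
have [_ cpsi _] := psiP _ ab0 aeta.
have /cvgrPdist_lt : (fun s => derive1 psi s * (4 * A)) @ (a - b) --> derive1 psi (a - b) * (4 * A).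
  by apply: cvgMl; exact: cpsi.
move=> /(_ (1 - derive1 psi (a - b) * (4 * A))) /(_ _)/nbhs_ballP[|e1 /= e10 He1].
  by rewrite subr_gt0.
have [e2 e20 He2] := (nbhs_enormP z0 U).1 z0U.
(* Below [e1] the product with [psi'] stays under 1, below [e2] the point stays in [U], and below
   [a - b] its value stays above [b]. *)
pose e := Num.min (Num.min e1 e2) (a - b) / 2.
have e0 : 0 < e by rewrite divr_gt0 // !lt_min e10 e20.
have ee1 : e < e1.
  by rewrite /e ltr_pdivrMr // (@le_lt_trans _ _ e1) ?ge_min ?lexx // ltr_pMr // ltr1n.
have ee2 : e < e2.
  by rewrite /e ltr_pdivrMr // (@le_lt_trans _ _ e2) ?ge_min ?lexx ?orbT // ltr_pMr // ltr1n.
have eab : e < a - b.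
  by rewrite /e ltr_pdivrMr // (@le_lt_trans _ _ (a - b)) ?ge_min ?lexx ?orbT // ltr_pMr // ltr1n.
have [z [v [c [zv vA zz0 Fz /andP[ac ca]]]]] := small_subgradient lF F_gt Fz0 A0 C0 d0 low e0.
have cb0 : 0 < c - b by lra.
have cb_eta : ((c - b)%:E < eta0)%E by apply: le_lt_trans aeta; rewrite lee_fin; lra.
have [_ _ psi'0] := psiP _ cb0 cb_eta.
have := KL z; rewrite Fzb Fz -EFinB lte_fin /= => /(_ (He2 _ (lt_trans zz0 ee2))).
case/(_ _ _)/Wrap => [||[]]; first by rewrite -subr_gt0.
  by rewrite -(subrKC b c) EFinD lteD2lE.
apply/negP; rewrite -ltNge.
apply: (@le_lt_trans _ _ (derive1 psi (c - b) * (4 * A))%:E).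
  rewrite EFinM lee_pmul2l //.
  apply: (@le_trans _ _ (enorm v)%:E); last by rewrite lee_fin.
  apply: ereal_inf_lbound; exists v => //; exact: frechet_lim_subdiff.
have := He1 (c - b); rewrite -ball_normE /= => /(_ _)/Wrap[].
  by rewrite (_ : _ - _ = a - c) ?ger0_norm; lra.
by rewrite lte_fin ltr_norml => /andP[]; lra.
Qed.

End Slope.

(** * Finite length and Bregman descent *)

(** AM-GM. With [s = S k] and [b = S k + S k.+1], the weight 1/4 leaves
    [3/4 * S k <= a + S k.+1 / 4], which can be summed. *)
Lemma sqr_le_mul_half (R : realType) (s a b : R) : 0 <= a -> 0 <= b ->
  s ^+ 2 <= a * b -> s <= a + b / 4.
Proof.
move=> a0 b0 sab; rewrite leNgt; apply/negP => abs.
have : 0 < (s - (a + b / 4)) * (s + (a + b / 4)) by rewrite mulr_gt0; lra.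
by have := sqr_ge0 (a - b / 4); nra.
Qed.

(* The inequality on [S k] is only available while the iterates stay close to
   [xt]; it bounds the length travelled so far, so they can never leave. *)
Lemma trapped_finite_length (R : realType) (n : nat) (x : nat -> 'rV[R]_n)
    (xt : 'rV[R]_n) (S p : nat -> R) (c kappa e : R) (N0 : nat) :
  0 <= c -> 0 <= kappa -> 0 < e ->
  (forall k, (N0 <= k)%N -> 0 <= S k) ->
  (forall k, (N0 <= k)%N -> 0 <= p k) ->
  (forall k, (N0 <= k)%N -> enorm (x k.+1 - x k) <= kappa * S k.+1) ->
  S @ \oo --> 0 -> p @ \oo --> 0 ->
  (forall (r : R) (N : nat), 0 < r -> exists2 k, (N <= k)%N & enorm (x k - xt) < r) ->
  (forall k, (N0 <= k)%N -> enorm (x k.+1 - xt) < e ->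
     p k.+1 <= p k /\ S k ^+ 2 <= c * (p k - p k.+1) * (S k + S k.+1)) ->
  exists (N : nat) (B : R), (N0 <= N)%N /\
    forall m, \sum_(i < m) S (N + i)%N <= B /\ enorm (x (N + m)%N - xt) < e.
Proof.
move=> c0 kap0 e0 S0 p0 dx Scvg pcvg freq rec.
(* The total drift will be at most [kappa * (2 * c * tau + 5/2 * sig)], that is at most [e/8 + e/8],
   starting from a point within [e/2] of [xt]. *)
pose tau := e / (16 * (kappa * c + 1)); pose sig := e / (20 * (kappa + 1)).
have kc0 : 0 <= kappa * c by rewrite mulr_ge0.
have tau0 : 0 < tau by rewrite divr_gt0 // mulr_gt0 //; lra.
have sig0 : 0 < sig by rewrite divr_gt0 // mulr_gt0 //; lra.
have tauE : kappa * c * tau <= e / 16.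
  rewrite /tau mulrA ler_pdivrMr; last by rewrite mulr_gt0 //; lra.
  by nra.
have sigE : kappa * sig <= e / 20.
  rewrite /sig mulrA ler_pdivrMr; last by rewrite mulr_gt0 //; lra.
  by nra.
move/cvgrPdist_lt: Scvg => /(_ _ sig0)[N1 _ SN1].
move/cvgrPdist_lt: pcvg => /(_ _ tau0)[N2 _ pN2].
have [N NN xN] := freq (e / 2) (N0 + N1 + N2)%N ltac:(lra).
have NN0 : (N0 <= N)%N by apply: leq_trans NN; rewrite -addnA leq_addr.
have NN1 : (N1 <= N)%N by apply: leq_trans NN; rewrite addnAC leq_addl.
have NN2 : (N2 <= N)%N by apply: leq_trans NN; rewrite leq_addl.
have ge0 m : (N0 <= N + m)%N by rewrite (leq_trans NN0) ?leq_addr.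
have Ssig m : S (N + m)%N < sig.
  have := SN1 (N + m)%N; rewrite /= sub0r normrN ger0_norm ?S0 //; apply.
  by rewrite (leq_trans NN1) ?leq_addr.
have pN : p N < tau.
  by have := pN2 N NN2; rewrite /= sub0r normrN ger0_norm ?p0.
pose T m := \sum_(i < m) S (N + i)%N.
have TS m : T m.+1 = T m + S (N + m)%N by rewrite /T big_ord_recr.
(* The first part telescopes [S k <= 2 * c * (p k - p k.+1) + (S k.+1 - S k) / 2]. The extra
   [S (N + m)] in the second is there because a step from [x k] is bounded through [S k.+1]. *)
suff inv m : T m <= 2 * c * (p N - p (N + m)%N) + (S (N + m)%N - S N) / 2 /\
    enorm (x (N + m)%N - xt) <= enorm (x N - xt) + kappa * (T m + S (N + m)%N).
  have TB m : T m <= 2 * c * tau + sig / 2.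
    have [+ _] := inv m; have := p0 _ (ge0 m); have := Ssig m; have := S0 _ NN0.
    by nra.
  exists N, (2 * c * tau + sig / 2); split=> // m; split; first exact: TB.
  have [_ +] := inv m; have := TB m; have := Ssig m => h1 h2 h3.
  have : kappa * (T m + S (N + m)%N) <= kappa * (2 * c * tau + sig / 2 + sig).
    by rewrite ler_wpM2l //; lra.
  by nra.
elim: m => [|m [IH1 IH2]].
  rewrite /T big_ord0 addn0 !subrr mulr0 mul0r addr0 lexx; split=> //.
  by rewrite lerDl add0r mulr_ge0 ?S0.
have T0 : T m <= 2 * c * tau + sig / 2.
  by have := p0 _ (ge0 m); have := Ssig m; have := S0 _ NN0; nra.
rewrite addnS TS; have := Ssig m.+1; rewrite addnS => S1.
(* The next iterate is located from the old sum alone, before [rec], which presupposes its closeness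
   to [xt], is applied. *)
have IH3 : enorm (x (N + m).+1 - xt) <=
    enorm (x N - xt) + kappa * (T m + S (N + m)%N + S (N + m).+1).
  have := enorm_triangle (x (N + m).+1) (x (N + m)%N) xt.
  have := dx _ (ge0 m); lra.
have /(rec _ (ge0 m)) [pp SS] : enorm (x (N + m).+1 - xt) < e.
  have := Ssig m => S2.
  have : kappa * (T m + S (N + m)%N + S (N + m).+1) <=
      kappa * (2 * c * tau + sig / 2 + sig + sig) by rewrite ler_wpM2l //; lra.
  by nra.
split=> //; have := @sqr_le_mul_half R (S (N + m)%N) (c * (p (N + m)%N - p (N + m).+1)) _ _ _ SS.
have Sm := S0 _ (ge0 m); have := S0 _ (ge0 m.+1); rewrite addnS => Sm1.
rewrite mulr_ge0 ?subr_ge0 // addr_ge0 // => /(_ isT isT).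
by lra.
Qed.

Lemma weighted_sqr_le (R : realType) (m n s t : R) :
  0 <= m -> 0 <= n -> 0 <= s -> 0 <= t ->
  m * s ^+ 2 + n * t ^+ 2 <= (m + n) * (s + t) ^+ 2.
Proof.
move=> m0 n0 s0 t0; rewrite mulrDl lerD // ler_wpM2l // ler_pXn2r ?nnegrE ?addr_ge0 //.
  by rewrite lerDl.
by rewrite lerDr.
Qed.

(** Used with [r] the distance from [x k.+2] to an auxiliary point [w], [tau] their Bregman
    distance, and [s], [t] the square roots of two successive merit gaps. *)
Lemma level_dist_le (R : realType) (M sigma l kap tau r s t : R) :
  0 < M -> 0 < sigma -> 0 <= l -> 0 <= r -> 0 <= s -> 0 <= t ->
  sigma / 2 * r ^+ 2 <= tau -> M * tau <= s ^+ 2 + M * (l * (kap * t) ^+ 2) ->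
  r <= Num.sqrt (2 / sigma * (M^-1 + l * kap ^+ 2)) * (s + t).
Proof.
move=> M0 sig0 l0 r0 s0 t0 rtau Mtau.
have Mi : 0 <= M^-1 by rewrite invr_ge0 ltW.
have lk : 0 <= l * kap ^+ 2 by rewrite mulr_ge0 ?sqr_ge0.
have C0 : 0 <= 2 / sigma * (M^-1 + l * kap ^+ 2).
  by rewrite mulr_ge0 ?addr_ge0 // divr_ge0 // ltW.
have sg : 0 < sigma / 2 by rewrite divr_gt0.
have tau_le : tau <= M^-1 * s ^+ 2 + l * kap ^+ 2 * t ^+ 2.
  by rewrite -(ler_pM2l M0) mulrDr mulVKf ?gt_eqF // -(mulrA l) -exprMn.
rewrite -(@ler_pXn2r _ 2) ?nnegrE ?mulr_ge0 ?addr_ge0 ?sqrtr_ge0 //.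
rewrite exprMn sqr_sqrtr // -(ler_pM2l sg) (le_trans rtau) // (le_trans tau_le) //.
rewrite [leRHS]mulrA (_ : sigma / 2 * _ = M^-1 + l * kap ^+ 2); first exact: weighted_sqr_le.
by field; rewrite !gt_eqF.
Qed.

(** * Optimality and descent for one Bregman proximal step *)

Section BregmanDescent.
Variables (R : realType) (d : nat).
Implicit Types (f h phi : 'rV[R]_d -> R) (g : 'rV[R]_d -> \bar R) (u v x y : 'rV[R]_d).

Lemma bregD f h (a b : R) u v : differentiable f v -> differentiable h v ->
  breg (fun w => a * f w + b * h w) u v = a * breg f u v + b * breg h u v.
Proof. by move=> df dh; rewrite /breg gradD // !dotE; ring. Qed.

(** Covers the convexity of both [L h - f] and [f + mu h], giving the upper and lower bounds of
    [breg f] by multiples of [breg h]. *)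
Lemma breg_combination_ge0 f h (a b : R) u v :
  differentiable f v -> differentiable h v ->
  convex_function setT ((fun w => a * f w + b * h w) : _ -> R^o) ->
  0 <= a * breg f u v + b * breg h u v.
Proof.
move=> df dh cfh; rewrite -bregD //; apply: breg_ge0 => //.
exact: (differentiableD (differentiableZ a df) (differentiableZ b dh)).
Qed.

(** Fermat's rule without a sum rule: compare [xp] with [xp + t (u - xp)], bound [g] there by
    convexity and let [t] tend to 0, so that only [h] is differentiated. Minimality against a point
    of the domain makes [g xp] finite. *)
Lemma bpg_subgradient f h g (lam : R) y xp :
  differentiable h xp -> eproper g -> econvex g ->
  (forall u, bpg_model f h g lam y xp <= bpg_model f h g lam y u)%E ->
  exists2 r : R, g xp = r%:E & forall u,
    ((r + dot (- grad f y - lam^-1 *: (grad h xp - grad h y)) (u - xp))%:E <= g u)%E.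
Proof.
move=> dh [g_gt [u0 gu0]] cg xpmin.
have [r gxp] : exists r : R, g xp = r%:E.
  have := xpmin u0; rewrite /bpg_model; have := g_gt xp; have := g_gt u0.
  by move: gu0; case: (g u0) => [s||] //; case: (g xp) => [r||] // _ _ _ _; exists r.
exists r => // u; have := g_gt u; case Egu : (g u) => [s||] // _; last by rewrite leey.
have := @grad_le_slope _ _ h xp (u - xp) (- lam^-1)
  (s - r + dot (u - xp) (grad f y) - lam^-1 * dot (grad h y) (u - xp)) 0 dh.
rewrite lee_fin (dotC _ (grad f y)) !dotBl dotNl dotZl dotBl => H.
suff : - lam^-1 * dot (grad h xp) (u - xp) <=
    s - r + dot (grad f y) (u - xp) - lam^-1 * dot (grad h y) (u - xp) by lra.
apply: H => t t0 t1.
have E : xp + t *: (u - xp) = t *: u + (1 - t) *: xp.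
  by apply/rowP => i; rewrite !mxE; ring.
have := cg u xp t t0 t1; rewrite -E Egu gxp -!EFinM -EFinD.
have := xpmin (xp + t *: (u - xp)); rewrite /bpg_model gxp.
have := g_gt (xp + t *: (u - xp)).
case: (g (xp + t *: (u - xp))) => [q _|_ _|//]; last by rewrite leye_eq.
rewrite -!EFinD !lee_fin.
rewrite /breg (_ : xp + t *: (u - xp) - y = (xp - y) + t *: (u - xp)); last by rewrite addrAC.
by move: (u - xp) (xp - y) => p w; rewrite !dotE !(dotC _ (grad f y)); lra.
Qed.

(** Add the upper bound of [f] at [(xp, y)], its lower bound at [(x, y)], the subgradient inequality
    and the three-point identity; the [breg h xp y] terms are absorbed because [L <= lam^-1]. *)
Lemma bpg_descent f h (L mu lam : R) (gx gxp : R) x y xp : 0 < lam -> lam <= L^-1 -> 0 < L ->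
  differentiable h y -> convex_function setT (h : _ -> R^o) ->
  (forall u v, breg f u v <= L * breg h u v) ->
  (forall u v, - mu * breg h u v <= breg f u v) ->
  gxp + dot (- grad f y - lam^-1 *: (grad h xp - grad h y)) (x - xp) <= gx ->
  f xp + gxp + lam^-1 * breg h x xp <= f x + gx + (lam^-1 + mu) * breg h x y.
Proof.
move=> lam0 lamL L0 dh ch fL fmu sub.
have Llam : L <= lam^-1 by rewrite -(invrK L) lef_pV2 // posrE ?invr_gt0.
have Dp : 0 <= breg h xp y by apply: breg_ge0.
have : L * breg h xp y <= lam^-1 * breg h xp y by rewrite ler_wpM2r.
have := fL xp y; have := fmu x y.
have := breg_three_point h x xp y; move: sub.
set Dxy := breg h x y; set Dpy := breg h xp y; set Dxp := breg h x xp.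
rewrite !dotBl dotNl dotZl dotBl /breg => sub.
rewrite (_ : x - y = (x - xp) + (xp - y)); last by rewrite addrA subrK.
rewrite (dotDr (grad f y) (x - xp)) => Dxy_split.
have : lam^-1 * Dxy = lam^-1 * Dxp + lam^-1 * Dpy +
    lam^-1 * (dot (grad h xp) (x - xp) - dot (grad h y) (x - xp)).
  by rewrite Dxy_split; ring.
clearbody Dxy Dpy Dxp; clear Dxy_split.
lra.
Qed.

End BregmanDescent.

(** * The merit function *)

Lemma cvg_dot (R : realType) (n : nat) (T : Type) (F : set_system T) {FF : Filter F}
    (p q : T -> 'rV[R]_n) (a b : 'rV[R]_n) :
  p @ F --> a -> q @ F --> b -> (fun t => dot (p t) (q t)) @ F --> dot a b.
Proof.
move=> pa qb; rewrite /dot.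
have coord (r : T -> 'rV[R]_n) (c : 'rV[R]_n) i :
    r @ F --> c -> (fun t => r t ord0 i) @ F --> c ord0 i.
  move=> rc; apply: (@cvg_comp _ _ _ r (fun z : 'rV[R]_n => z ord0 i) F (nbhs c)) => //.
  exact: coord_continuous.
apply: (@cvg_big R^o) => [|i _]; first exact: add_continuous.
by apply: cvgM; exact: coord.
Qed.

Section Merit.
Variables (R : realType) (d : nat).
Implicit Types (f h phi : 'rV[R]_d -> R) (g : 'rV[R]_d -> \bar R) (u v w x y : 'rV[R]_d).

Lemma dot_row_mx (u v w y : 'rV[R]_d) :
  dot (row_mx u v) (row_mx w y) = dot u w + dot v y.
Proof.
rewrite /dot big_split_ord; congr (_ + _); apply: eq_bigr => i _.
  by rewrite !row_mxEl.
by rewrite !row_mxEr.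
Qed.

Lemma enorm_row_mx_le u v : enorm (row_mx u v) <= enorm u + enorm v.
Proof.
rewrite -(@ler_pXn2r _ 2) ?nnegrE ?addr_ge0 ?enorm_ge0 //.
rewrite sqr_enorm dot_row_mx -!sqr_enorm.
by have := enorm_ge0 u; have := enorm_ge0 v; nra.
Qed.

Lemma enorm_lsubmx_le (z : 'rV[R]_(d + d)) : enorm (lsubmx z) <= enorm z.
Proof.
by rewrite /enorm ler_wsqrtr // -[in leRHS](hsubmxK z) dot_row_mx lerDl dot_ge0.
Qed.

Lemma enorm_rsubmx_le (z : 'rV[R]_(d + d)) : enorm (rsubmx z) <= enorm z.
Proof.
by rewrite /enorm ler_wsqrtr // -[in leRHS](hsubmxK z) dot_row_mx lerDr dot_ge0.
Qed.

(** Four quarters of [r]: one for the distance to [(u, v)], two for [|u - w|], which enters through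
    both components, and one for [|v - u|]. *)
Lemma nbhs_row_mx u v w (U : set 'rV[R]_(d + d)) (r : R) : 0 < r ->
  (forall z, enorm (z - row_mx w w) < r -> U z) ->
  enorm (u - w) < r / 4 -> enorm (v - u) < r / 4 -> nbhs (row_mx u v) U.
Proof.
move=> r0 rU uw vu; apply/nbhs_enormP; exists (r / 4); first by rewrite divr_gt0.
move=> z zr; apply: rU.
have t1 := enorm_triangle z (row_mx u v) (row_mx w w).
have t2 : enorm (row_mx u v - row_mx w w) <= enorm (u - w) + enorm (v - w).
  by rewrite opp_row_mx add_row_mx enorm_row_mx_le.
have t3 := enorm_triangle v u w.
by lra.
Qed.

Lemma lower_semicontinuous_merit f h g (M : R) :
  (forall u, differentiable f u) -> C1 h -> lower_semicontinuous g ->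
  lower_semicontinuous (merit f h g M).
Proof.
move=> df [dh ch] lg.
have cl : continuous (@lsubmx R 1 d d).
  by move=> z; apply: differentiable_continuous; exact: differentiable_lsubmx.
have cr : continuous (@rsubmx R 1 d d).
  by move=> z; apply: differentiable_continuous; exact: differentiable_rsubmx.
have cf u : {for u, continuous f} by apply: differentiable_continuous.
have chh u : {for u, continuous h} by apply: differentiable_continuous.
(* Regrouped as a lower semicontinuous term plus a continuous real one. *)
rewrite (_ : merit f h g M = fun z => g (lsubmx z) +
    (f (lsubmx z) + M * breg h (rsubmx z) (lsubmx z))%:E)%E; last first.
  by apply/funext => z; rewrite /merit /Psi EFinD addeA (addeC (f _)%:E).
apply: lower_semicontinuousD.
  move=> z a /lg[V zV Va]; exists (@lsubmx R 1 d d @^-1` V); first exact: cl.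
  by move=> y /Va.
move=> z; have flt := nbhs_filter z.
have l := cl z; have r := cr z.
have comp (F : 'rV[R]_d -> R) (s : 'rV[R]_(d + d) -> 'rV[R]_d) :
    {for s z, continuous F} -> s @ z --> s z -> (F \o s) @ z --> F (s z).
  by move=> cF cs; exact: (@cvg_comp _ _ _ s F (nbhs z) (nbhs (s z))).
apply: (@cvgD R R^o); first exact: comp.
apply: (@cvgMr R); rewrite /breg; apply: (@cvgB R R^o).
  by apply: (@cvgB R R^o); apply: comp.
apply: cvg_dot.
  exact: cvg_comp l (ch _).
exact: (cvgB r l).
Qed.

Lemma dot_dist_le (G : 'rV[R]_d -> 'rV[R]_d) (l : R) u v w (s t : R) :
  enorm (G u - G v) <= l * enorm (u - v) -> 0 <= l -> enorm (u - v) <= s -> enorm w <= t ->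
  `|dot (G u - G v) w| <= l * s * t.
Proof.
move=> lip l0 us wt.
have b : enorm (G u - G v) * enorm w <= l * s * t.
  rewrite ler_pM ?enorm_ge0 //; apply: le_trans lip _; exact: ler_wpM2l.
rewrite ler_norml (le_trans (dot_le_enorm _ _) b) andbT.
by rewrite (le_trans _ (dot_ge_enorm _ _)) // lerN2.
Qed.

(** Relative weak convexity costs only [mu * breg h u x], a quadratic error, so [grad f x + xi] acts
    as a subgradient of [Psi] up to second order. *)
Lemma Psi_lower_bound f h g (mu l gx : R) x u xi :
  0 <= mu -> 0 <= l ->
  (forall u v, - mu * breg h u v <= breg f u v) ->
  (forall u, ((gx + dot xi (u - x))%:E <= g u)%E) ->
  breg h u x <= l * enorm (u - x) ^+ 2 ->
  ((f x + gx + dot (grad f x + xi) (u - x) - mu * l * enorm (u - x) ^+ 2)%:E <= Psi f g u)%E.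
Proof.
move=> mu0 l0 fmu sub hl.
have : mu * breg h u x <= mu * l * enorm (u - x) ^+ 2 by rewrite -mulrA ler_wpM2l.
have := fmu u x; rewrite {2}/breg dotDl /Psi => h1 h2.
apply: le_trans (leeD2l (f u)%:E (sub u)).
by rewrite -EFinD lee_fin; lra.
Qed.

Lemma breg_le_lipschitz h (l : R) u v : differentiable h u ->
  convex_function setT (h : _ -> R^o) ->
  enorm (grad h u - grad h v) <= l * enorm (u - v) ->
  breg h u v <= l * enorm (u - v) ^+ 2.
Proof.
move=> dh ch lip; apply: le_trans (breg_le_dot v dh ch) _.
apply: le_trans (dot_le_enorm _ _) _.
by rewrite expr2 mulrA ler_wpM2r ?enorm_ge0.
Qed.

(* [w] is arbitrary, so that every level of the merit function can be reached
   with a controlled slope. *)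
Lemma merit_lower_bound f h g (mu M l B gx A : R) x w xi (z : 'rV[R]_(d + d)) :
  (forall u, differentiable h u) -> convex_function setT (h : _ -> R^o) ->
  0 <= mu -> 0 <= M -> 0 <= l ->
  (forall u v, - mu * breg h u v <= breg f u v) ->
  (forall u v, enorm u <= B + 1 -> enorm v <= B + 1 ->
     enorm (grad h u - grad h v) <= l * enorm (u - v)) ->
  (forall u, ((gx + dot xi (u - x))%:E <= g u)%E) ->
  enorm x <= B -> enorm w <= B ->
  enorm (grad f x + xi) + 2 * M * l * enorm (w - x) <= A ->
  enorm (z - row_mx x w) <= 1 ->
  ((f x + gx + M * breg h w x - A * enorm (z - row_mx x w) -
    (mu + M) * l * enorm (z - row_mx x w) ^+ 2)%:E <= merit f h g M z)%E.
Proof.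
move=> dh ch mu0 M0 l0 fmu lip sub xB wB A_ge z1.
set s := enorm _ in z1 *.
have s0 : 0 <= s by exact: enorm_ge0.
rewrite /merit; set u := lsubmx z; set w' := rsubmx z.
have us : enorm (u - x) <= s.
  by have := enorm_lsubmx_le (z - row_mx x w); rewrite linearB /= row_mxKl.
have ws : enorm (w' - w) <= s.
  by have := enorm_rsubmx_le (z - row_mx x w); rewrite linearB /= row_mxKr.
have uB : enorm u <= B + 1.
  have := enormD (u - x) x; rewrite subrK; lra.
have lux : enorm (grad h u - grad h x) <= l * enorm (u - x) by apply: lip => //; lra.
have := @Psi_lower_bound f h g mu l gx x u xi mu0 l0 fmu sub (breg_le_lipschitz (dh u) ch lux).
move/(leeD2r (M * breg h w' u)%:E); apply: le_trans.
rewrite -EFinD lee_fin.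
have b1 : dot (grad f x + xi) (u - x) >= - (enorm (grad f x + xi) * s).
  by rewrite (le_trans _ (dot_ge_enorm _ _)) // lerN2 ler_wpM2l ?enorm_ge0.
have b2 : mu * l * enorm (u - x) ^+ 2 <= mu * l * s ^+ 2.
  by rewrite ler_wpM2l ?mulr_ge0 // ler_pXn2r ?nnegrE ?enorm_ge0.
have b3 : `|dot (grad h w - grad h u) (w' - w)| <= l * (enorm (w - x) + s) * s.
  apply: dot_dist_le => //; first by apply: lip => //; lra.
  by have := enorm_triangle w x u; rewrite (enormB x u); lra.
have b4 : `|dot (grad h u - grad h x) (w - x)| <= l * s * enorm (w - x).
  by apply: dot_dist_le.
(* [breg h w' u - breg h w x] is the sum of [breg h w' w], [breg h x u],
   [dot (grad h w - grad h u) (w' - w)] and [dot (grad h x - grad h u) (w - x)]. The first two are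
   nonnegative by convexity; the others are bounded by the Lipschitz property, without
   differentiating [grad h]. *)
have b5 := convex_grad_le w' (dh w) ch; have b6 := convex_grad_le x (dh u) ch.
have b7 : M * (- (2 * l * s * enorm (w - x)) - l * s ^+ 2) <= M * (breg h w' u - breg h w x).
  rewrite ler_wpM2l // /breg.
  move: b3 b4; rewrite !ler_norml => /andP[b3 _] /andP[_ b4].
  have E1 : w' - u = (w' - w) + (w - x) + (x - u) by apply/rowP => i; rewrite !mxE; ring.
  move: b3 b4 b5 b6; rewrite E1 !dotBl.
  move: (w' - w) (w - x) (x - u) => p q r; rewrite !dotE.
  by lra.
have b8 : (enorm (grad f x + xi) + 2 * M * l * enorm (w - x)) * s <= A * s by rewrite ler_wpM2r.
by nra.
Qed.

(** Intermediate value theorem along the ray [x + t v]: the distance vanishes at [t = 0] and grows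
    at least quadratically. *)
Lemma breg_level h (sigma : R) v (tau : R) x : C1 h -> 0 < sigma ->
  strongly_convex sigma h -> v != 0 -> 0 <= tau -> exists w, breg h w x = tau.
Proof.
move=> [dh _] s0 sc v0 tau0.
have v_gt0 : 0 < enorm v.
  by rewrite lt_def enorm_ge0 andbT; apply: contra_neq v0 => /enorm_eq0.
pose phi t := breg h (x + t *: v) x.
(* Since [T >= 1], [T ^+ 2 >= T - 1], so [sigma / 2 * T ^+ 2 * |v|^2 >= tau] without a square
   root. *)
pose T := (2 * tau / sigma / enorm v ^+ 2 + 1).
have q0 : 0 <= 2 * tau / sigma / enorm v ^+ 2.
  by rewrite divr_ge0 ?sqr_ge0 // divr_ge0 ?mulr_ge0 // ltW.
have cphi : continuous phi.
  move=> t.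
  have ct : (fun t : R => x + t *: v) @ t --> x + t *: v.
    by apply: cvgD; [exact: cvg_cst|apply: cvgZr_tmp; exact: cvg_id].
  rewrite /phi /breg; apply: (@cvgB R R^o).
    apply: (@cvgB R R^o); last exact: cvg_cst.
    apply: (@cvg_comp _ _ _ (fun t => x + t *: v) h (nbhs t) (nbhs (x + t *: v))) => //.
    exact: differentiable_continuous (dh _).
  apply: cvg_dot; first exact: cvg_cst.
  by apply: cvgB => //; exact: cvg_cst.
have phiT : tau <= phi T.
  apply: le_trans (strongly_convex_breg _ (dh x) sc).
  rewrite addrC addKr enormZ exprMn real_normK ?num_real //.
  have TE : (T - 1) * enorm v ^+ 2 * sigma = 2 * tau.
    by rewrite /T addrK !divfK // gt_eqF // exprn_gt0.
  have : 1 <= T by rewrite /T; lra.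
  have := exprn_gt0 2 v_gt0; move: TE; set e := enorm v ^+ 2; move=> TE e0 T1.
  have : 0 <= (T ^+ 2 - (T - 1)) * (e * sigma) by rewrite mulr_ge0 ?mulr_ge0 // ?ltW //; nra.
  by nra.
have phi0 : phi 0 = 0 by rewrite /phi scale0r addr0 breg_self.
have [|||t _ tE] := @IVT R phi 0 T tau.
- by rewrite /T; lra.
- exact: continuous_subspaceT.
- by rewrite phi0 ge_min le_max tau0 phiT orbT.
by exists (x + t *: v).
Qed.

End Merit.

(** The value [a = 0] must be allowed; right continuity of [psi] there suffices for the mean value
    theorem. *)
Lemma desingularizing_MVT (R : realType) (eta0 : \bar R) (psi : R -> R) (a b : R) :
  desingularizing eta0 psi -> 0 <= a -> a < b -> (b%:E < eta0)%E ->
  exists s, [/\ a < s, s < b, 0 < derive1 psi s & psi b - psi a = derive1 psi s * (b - a)].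
Proof.
move=> [psi0 _ cpsi psiP] a0 ab beta.
have psiS (s : R) : 0 < s -> s <= b ->
    [/\ derivable psi s 1, {for s, continuous (derive1 psi)} & 0 < derive1 psi s].
  by move=> s0 sb; apply: psiP => //; apply: le_lt_trans beta; rewrite lee_fin.
have cs (s : R) : 0 < s -> s <= b -> {for s, continuous psi}.
  move=> s0 sb; case: (psiS s s0 sb) => ds _ _.
  by apply: differentiable_continuous; apply/derivable1_diffP.
have b0 : 0 < b by lra.
have [||s] := @MVT R psi (derive1 psi) a b ab.
- move=> s; rewrite in_itv /= => /andP[sa sb].
  have [ds _ _] := psiS s (le_lt_trans a0 sa) (ltW sb).
  by rewrite derive1E; exact: (derivableP ds).
- apply/(continuous_within_itvP _ ab); split.
  + by move=> s; rewrite in_itv /= => /andP[sa sb]; apply: cs; lra.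
  + have [->|an0] := eqVneq a 0; first exact: cpsi.
    by apply: cvg_at_right_filter; apply: cs; [rewrite lt_def an0|lra].
  + by apply: cvg_at_left_filter; apply: cs.
rewrite in_itv /= => /andP[sa sb] E; exists s; split => //.
by have [] := psiS s (le_lt_trans a0 sa) (ltW sb).
Qed.

(** * Convergence of the iteration *)

Section Convergence.
Variables (R : realType) (d : nat) (f h : 'rV[R]_d -> R) (g : 'rV[R]_d -> \bar R).
Variables (L mu eta betahat rho : R) (lam : nat -> R) (M sigma : R).
Variables (x : nat -> 'rV[R]_d) (xt : 'rV[R]_d).
Hypothesis f_diff : forall u, differentiable f u.
Hypothesis g_proper : eproper g.
Hypothesis g_lsc : lower_semicontinuous g.
Hypothesis g_convex : econvex g.
Hypothesis Psi_bounded : (-oo < ereal_inf (range (Psi f g)))%E.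
Hypothesis h_C1 : C1 h.
Hypothesis h_convex : convex_function setT (h : _ -> R^o).
Hypothesis L_gt0 : 0 < L.
Hypothesis f_upper : forall u v, breg f u v <= L * breg h u v.
Hypothesis mu_ge0 : 0 <= mu.
Hypothesis f_lower : forall u v, - mu * breg h u v <= breg f u v.
Hypothesis Psi_supercoercive : supercoercive (Psi f g).
Hypothesis eta01 : 0 <= eta <= 1.
Hypothesis betahat01 : 0 <= betahat <= 1.
Hypothesis rho_gt0 : 0 < rho.
Hypothesis lam_gt0 : forall k, 0 < lam k.
Hypothesis lam_le : forall k, lam k <= L^-1.
Hypothesis inf_lam_gt0 : 0 < inf (range lam).
Hypothesis M_gt : rho * (inf (range lam))^-1 < M.
Hypothesis M_le : M <= (sup (range lam))^-1.
Hypothesis x_BPGe : is_BPGe f h g mu eta betahat rho lam x.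
Hypothesis sigma_gt0 : 0 < sigma.
Hypothesis h_strongly_convex : strongly_convex sigma h.
Hypothesis grad_h_lipschitz : forall B : set 'rV[R]_d, bounded_set B ->
  [lipschitz grad h u | u in B].
Hypothesis grad_f_lipschitz : forall B : set 'rV[R]_d, bounded_set B ->
  [lipschitz grad f u | u in B].
Hypothesis xt_limit_point :
  cluster (row_mx (x k) (x k.-1) @[k --> \oo]) (row_mx xt xt).
Hypothesis merit_KL : KL_at (merit f h g M) (row_mx xt xt).

(** The true objective value for [k >= 1]; [x 0] may lie outside the domain of [g], where [fine]
    returns a default value, so [real_merit k] starts from [x k.+1]. *)
Definition real_obj k : R := f (x k) + fine (g (x k)).
Definition real_merit k : R := real_obj k.+1 + M * breg h (x k) (x k.+1).
Definition step_len k : R := enorm (x k.+1 - x k).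
Local Notation E := real_merit.
Local Notation D := step_len.

(** * Descent of the merit values and boundedness *)

Lemma M_gt0 : 0 < M.
Proof. by apply: lt_trans M_gt; rewrite mulr_gt0 ?invr_gt0. Qed.

Lemma lam_bounds k : [/\ (lam k)^-1 <= (inf (range lam))^-1 & M <= (lam k)^-1].
Proof.
have sup_ge : lam k <= sup (range lam).
  apply: ub_le_sup; last by exists k.
  by exists L^-1 => _ [j _ <-].
split; last by rewrite (le_trans M_le) // lef_pV2 ?posrE // (lt_le_trans (lam_gt0 k)).
rewrite lef_pV2 ?posrE //; apply: ge_inf; last by exists k.
by exists 0 => _ [j _ <-]; exact: ltW.
Qed.

Lemma bpge_step k : exists (y : 'rV[R]_d) (r : R),
  [/\ enorm (y - x k) <= enorm (x k - x k.-1),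
      breg h (x k) y <= rho * ((lam k)^-1 / ((lam k)^-1 + mu)) * breg h (x k.-1) (x k),
      g (x k.+1) = r%:E &
      forall u, ((r + dot (- grad f y - (lam k)^-1 *: (grad h (x k.+1) - grad h y))
        (u - x k.+1))%:E <= g u)%E].
Proof.
have [j [ok _ xmin]] := x_BPGe k.
have [r gr sub] := bpg_subgradient (h_C1.1 _) g_proper g_convex xmin.
exists (extrapolate x k (eta ^+ j * betahat)), r; split=> //.
have [/andP[e0 e1] /andP[b0 b1]] := (eta01, betahat01).
rewrite /extrapolate addrC addKr enormZ ger0_norm ?mulr_ge0 ?exprn_ge0 //.
by rewrite ler_piMl ?enorm_ge0 // mulr_ile1 ?exprn_ge0 // exprn_ile1.
Qed.

Lemma obj_fin k : (Psi f g (x k.+1) = (real_obj k.+1)%:E)%E.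
Proof. by have [y [r [_ _ gr _]]] := bpge_step k; rewrite /Psi /real_obj gr. Qed.

Lemma h_breg_ge0 u v : 0 <= breg h u v.
Proof. by apply: breg_ge0 => //; exact: h_C1.1. Qed.

(** [bpg_descent] from [x k.+1] to [x k.+2]: the line-search factor cancels [(lam k.+1)^-1 + mu],
    leaving [rho * (lam k.+1)^-1 * breg h (x k) (x k.+1)], and [M <= (lam k.+1)^-1] turns the left
    side into [E k.+1]. *)
Lemma merit_descent k :
  E k.+1 + (M - rho * (inf (range lam))^-1) * breg h (x k) (x k.+1) <= E k.
Proof.
have [y [r [_ ls gr sub]]] := bpge_step k.+1.
have [y' [r' [_ _ gr' _]]] := bpge_step k.
have [l1 l2] := lam_bounds k.+1.
have := sub (x k.+1); rewrite gr' lee_fin.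
move=> /(bpg_descent (lam_gt0 _) (lam_le _) L_gt0 (h_C1.1 _) h_convex f_upper f_lower).
rewrite /real_merit /real_obj gr gr' /=.
have li : 0 < (lam k.+1)^-1 by rewrite invr_gt0.
have lm : 0 < (lam k.+1)^-1 + mu by rewrite ltr_wpDr.
have : ((lam k.+1)^-1 + mu) * breg h (x k.+1) y <= rho * (lam k.+1)^-1 * breg h (x k) (x k.+1).
  move: ls; rewrite -(ler_pM2l lm) => /le_trans; apply.
  rewrite le_eqVlt; apply/orP; left; apply/eqP => /=.
  move: ((lam k.+1)^-1 + mu) lm => b b0; move: (lam k.+1)^-1 => c.
  by field; rewrite gt_eqF.
have h1 : M * breg h (x k.+1) (x k.+2) <= (lam k.+1)^-1 * breg h (x k.+1) (x k.+2).
  by rewrite ler_wpM2r ?h_breg_ge0.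
have h2 : rho * (lam k.+1)^-1 * breg h (x k) (x k.+1) <=
    rho * (inf (range lam))^-1 * breg h (x k) (x k.+1).
  by rewrite ler_wpM2r ?h_breg_ge0 // ler_wpM2l // ltW.
by lra.
Qed.

Lemma merit_descent_sqr : exists2 a : R, 0 < a & forall k, a * D k ^+ 2 <= E k - E k.+1.
Proof.
exists ((M - rho * (inf (range lam))^-1) * (sigma / 2)).
  by rewrite mulr_gt0 ?subr_gt0 // divr_gt0.
move=> k; have := merit_descent k.
have := strongly_convex_breg (x k) (h_C1.1 (x k.+1)) h_strongly_convex.
rewrite enormB -/(D k) => b1.
have : (M - rho * (inf (range lam))^-1) * (sigma / 2 * D k ^+ 2) <=
   (M - rho * (inf (range lam))^-1) * breg h (x k) (x k.+1).
  by rewrite ler_wpM2l // subr_ge0 ltW.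
by lra.
Qed.

Lemma obj_le_merit k : real_obj k.+1 <= E k.
Proof. by rewrite lerDl mulr_ge0 ?h_breg_ge0 // ltW // M_gt0. Qed.

Lemma merit_noninc k m : (k <= m)%N -> E m <= E k.
Proof.
move=> km; rewrite -(subnKC km); elim: (m - k)%N => [|j IH]; first by rewrite addn0.
rewrite addnS (le_trans _ IH) // -subr_ge0.
have [a a0 aE] := merit_descent_sqr.
by apply: le_trans (aE _); rewrite mulr_ge0 ?sqr_ge0 // ltW.
Qed.

Lemma merit_bounded_below : exists m : R, forall k, m <= E k.
Proof.
have [m mP] : exists m : R, forall u, (m%:E <= Psi f g u)%E.
  have lb u : (ereal_inf (range (Psi f g)) <= Psi f g u)%E.
    by apply: ereal_inf_lbound; exists u.
  move: Psi_bounded lb; case: (ereal_inf _) => [m||] // _ lb; first by exists m.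
  by exists 0 => u; apply: le_trans (lb u); rewrite leey.
exists m => k; apply: le_trans (obj_le_merit k).
by rewrite -lee_fin -obj_fin.
Qed.

(** Supercoercivity with slope 1: far out, the norm is at most the objective, itself at most
    [E 0]. *)
Lemma iterates_bounded : exists2 B : R, 0 <= B & forall k, enorm (x k) <= B.
Proof.
have [r [r0 rP]] := Psi_supercoercive 1.
exists (Num.max (enorm (x 0%N)) (Num.max r (E 0%N))); first by rewrite le_max enorm_ge0.
case=> [|k]; first by rewrite le_max lexx.
have [xr|xr] := leP (enorm (x k.+1)) r; first by rewrite !le_max xr !orbT.
have := rP _ xr; rewrite obj_fin -EFinM lee_fin.
rewrite ler_pdivlMr ?mul1r; last exact: lt_trans xr.
move=> xo; have := le_trans (obj_le_merit k) (merit_noninc (leq0n k)).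
by move/(le_trans xo) => xE; rewrite !le_max xE !orbT.
Qed.

Lemma merit_cvg : exists l : R, E @ \oo --> l.
Proof.
have [m mE] := merit_bounded_below.
have /cvg_ex[l lP] : cvgn E.
  apply: nonincreasing_is_cvgn; first by move=> k j; exact: merit_noninc.
  by exists m => _ [k _ <-].
by exists l.
Qed.

Lemma merit_gap_cvg0 : (fun k => Num.sqrt (E k - E k.+1)) @ \oo --> 0.
Proof.
have [l El] := merit_cvg.
rewrite -(@sqrtr0 R).
apply: (@cvg_comp _ _ _ (fun k => E k - E k.+1) Num.sqrt _ (nbhs 0)).
  by rewrite -(subrr l); apply: cvgB => //; rewrite cvg_shiftS.
exact: sqrt_continuous.
Qed.

Lemma step_len_le : exists2 kappa : R, 0 <= kappa &
  forall k, D k <= kappa * Num.sqrt (E k - E k.+1).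
Proof.
have [a a0 aE] := merit_descent_sqr.
exists (Num.sqrt a)^-1; first by rewrite invr_ge0 sqrtr_ge0.
move=> k; rewrite mulrC ler_pdivlMr ?sqrtr_gt0 //.
have -> : D k * Num.sqrt a = Num.sqrt (a * D k ^+ 2).
  by rewrite sqrtrM ?ltW // sqrtr_sqr ger0_norm ?enorm_ge0 // mulrC.
by rewrite ler_wsqrtr.
Qed.

Lemma step_len_cvg0 (e : R) : 0 < e -> exists N, forall k, (N <= k)%N -> D k < e.
Proof.
have [kappa k0 kD] := step_len_le; move=> e0.
have e'0 : 0 < e / (kappa + 1) by rewrite divr_gt0 // ltr_wpDl.
have /cvgrPdist_lt/(_ _ e'0)[N _ NP] := merit_gap_cvg0.
exists N => k /NP; rewrite /= sub0r normrN ger0_norm ?sqrtr_ge0 //.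
rewrite ltr_pdivlMr ?ltr_wpDl //; have := kD k; have := sqrtr_ge0 (E k - E k.+1).
by nra.
Qed.

(** Adding [grad f (x k.+2)] to the subgradient of the step leaves differences of [grad f] and
    [grad h] between [x k.+2] and [y], two points at distance at most [D k.+1 + D k]. *)
Lemma iterates_subgradient : exists B l c : R, [/\ 0 <= l, 0 <= c,
  forall k, enorm (x k) <= B,
  forall u v, enorm u <= B + 2 -> enorm v <= B + 2 ->
     enorm (grad h u - grad h v) <= l * enorm (u - v) &
  forall k, exists2 xi : 'rV[R]_d,
    forall u, ((fine (g (x k.+2)) + dot xi (u - x k.+2))%:E <= g u)%E &
    enorm (grad f (x k.+2) + xi) <= c * (D k.+1 + D k)].
Proof.
have [B B0 xB] := iterates_bounded.
(* Extrapolated points have norm at most [3 * B]; the [+ 2] leaves room for unit balls about points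
   of norm at most [B + 1]. *)
have [l l0 lP] := @lipschitz_enorm _ _ _ (3 * B + 2) grad_h_lipschitz.
have [lf lf0 lfP] := @lipschitz_enorm _ _ _ (3 * B + 2) grad_f_lipschitz.
have i0 : 0 <= (inf (range lam))^-1 by rewrite invr_ge0 ltW.
exists B, l, (lf + (inf (range lam))^-1 * l); split => //.
- by rewrite addr_ge0 // mulr_ge0.
- by move=> u v ur vr; apply: lP; lra.
move=> k; have [y [r [yx _ gr sub]]] := bpge_step k.+1.
exists (- grad f y - (lam k.+1)^-1 *: (grad h (x k.+2) - grad h y)).
  by move=> u; rewrite gr; exact: sub.
have yB : enorm y <= 3 * B + 2.
  have := enormD (y - x k.+1) (x k.+1); rewrite subrK.
  have := enorm_triangle (x k.+1) 0 (x k); rewrite subr0 sub0r enormN.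
  by have := xB k; have := xB k.+1; move: yx => /=; lra.
have xyD : enorm (x k.+2 - y) <= D k.+1 + D k.
  have := enorm_triangle (x k.+2) (x k.+1) y; rewrite (enormB (x k.+1) y).
  by move: yx; rewrite /step_len /=; lra.
have xB2 : enorm (x k.+2) <= 3 * B + 2 by have := xB k.+2; lra.
have := lP _ _ xB2 yB; have := lfP _ _ xB2 yB => hf hh.
have [l1 _] := lam_bounds k.+1.
have li : 0 <= (lam k.+1)^-1 by rewrite invr_ge0 ltW.
rewrite addrA; apply: (le_trans (enormD _ _)); rewrite enormN enormZ ger0_norm //.
have h1 : (lam k.+1)^-1 * enorm (grad h (x k.+2) - grad h y) <=
    (inf (range lam))^-1 * (l * enorm (x k.+2 - y)) by rewrite ler_pM ?enorm_ge0.
have h2 : (lf + (inf (range lam))^-1 * l) * enorm (x k.+2 - y) <=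
    (lf + (inf (range lam))^-1 * l) * (D k.+1 + D k).
  by rewrite ler_wpM2l // addr_ge0 // mulr_ge0.
by apply: le_trans h2; rewrite mulrDl -mulrA lerD.
Qed.

(** * The limit point and the KL recursion *)

Lemma iterates_frequently_near (r : R) (N : nat) : 0 < r ->
  exists2 k, (N <= k)%N & enorm (x k - xt) < r.
Proof.
move=> r0.
have /(_ [set z | exists2 k, (N <= k)%N & z = row_mx (x k) (x k.-1)]) := xt_limit_point.
move=> /(_ [set z | enorm (z - row_mx xt xt) < r]) [||z [[k Nk ->] /= zr]].
- by exists N => // k /= Nk; exists k.
- exact: near_enorm.
exists k => //; apply: le_lt_trans zr.
by have := enorm_lsubmx_le (row_mx (x k) (x k.-1) - row_mx xt xt);
  rewrite linearB /= !row_mxKl.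
Qed.

(* By semicontinuity the merit values dominate the objective at [xt], and the
   subgradient inequality at [x k], tested at [xt], gives the reverse bound. *)
Lemma merit_limit : exists b : R, [/\ Psi f g xt = b%:E,
  merit f h g M (row_mx xt xt) = b%:E, forall k, b <= E k & E @ \oo --> b].
Proof.
(* The KL property includes a nonempty subdifferential, hence a finite value, at the limit point. *)
have [[v [zb_fin _]] _] := merit_KL.
have meritE : merit f h g M (row_mx xt xt) = Psi f g xt.
  by rewrite /merit row_mxKl row_mxKr breg_self mulr0 adde0.
have [gt gtE] : exists gt : R, g xt = gt%:E.
  have := zb_fin; rewrite meritE /Psi; have := g_proper.1 xt.
  by case: (g xt) => [r||] // _ _; exists r.
pose b := f xt + gt.
have PsiE : Psi f g xt = b%:E by rewrite /Psi gtE.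
have bE k : b <= E k.
  rewrite leNgt; apply/negP => Ekb.
  have lPsi : lower_semicontinuous (Psi f g).
    rewrite (_ : Psi f g = fun u => (g u + (f u)%:E)%E).
      by apply: lower_semicontinuousD => // u; exact: differentiable_continuous (f_diff u).
    by apply/funext => u; rewrite /Psi addeC.
  have [V xtV VE] := lPsi xt (E k) ltac:(by rewrite PsiE lte_fin).
  have [r r0 rV] := (nbhs_enormP xt V).1 xtV.
  have [[//|j] kj xj] := iterates_frequently_near k.+1 r0.
  have := VE _ (rV _ xj); rewrite obj_fin lte_fin ltNge.
  by rewrite (le_trans (obj_le_merit j)) // merit_noninc.
exists b; split => //; first by rewrite meritE.
have [B [l [c [l0 c0 xB lip sub]]]] := iterates_subgradient.
suff small (e : R) : 0 < e -> exists k, E k < b + e.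
  apply/cvgrPdist_lt => e /small[k kE]; exists k => // j /= kj.
  rewrite distrC ger0_norm ?subr_ge0 //.
  by have := merit_noninc kj; lra.
(* One error term each for the slope, the weak convexity of [f] and the Bregman part of [E]. *)
move=> e0; pose C := 2 * c + mu * l + M * l.
have M0 := M_gt0.
have C0 : 0 <= C by rewrite !addr_ge0 ?mulr_ge0 // ltW.
pose tau := Num.min 1 (e / (C + 1)).
have tau0 : 0 < tau by rewrite lt_min ltr01 divr_gt0 // ltr_wpDl.
have tau1 : tau <= 1 by rewrite ge_min lexx.
have tauC : C * tau < e.
  have : tau <= e / (C + 1) by rewrite ge_min lexx orbT.
  by rewrite ler_pdivlMr ?ltr_wpDl //; lra.
have [N ND] := step_len_cvg0 tau0.
have [[//|[//|k]] Nk xk] := iterates_frequently_near N.+2 tau0.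
exists k.+1; have [xi sub_xi xi_le] := sub k.
have D1 : D k.+1 < tau by apply: ND; rewrite -ltnS ltnW.
have D2 : D k < tau by apply: ND.
have [s0 d0] : 0 <= enorm (x k.+2 - xt) /\ 0 <= D k.+1 by rewrite !enorm_ge0.
have := sub_xi xt; rewrite gtE lee_fin => gxt.
have dhx : differentiable h xt by exact: h_C1.1.
have xtB : enorm xt <= B + 2.
  have := enormD (xt - x k.+2) (x k.+2); rewrite subrK (enormB xt).
  by have := xB k.+2; lra.
have xB2 j : enorm (x j) <= B + 2 by have := xB j; lra.
have h1 := breg_le_lipschitz dhx h_convex (lip _ _ xtB (xB2 k.+2)).
have h2 := breg_le_lipschitz (h_C1.1 (x k.+1)) h_convex (lip _ _ (xB2 k.+1) (xB2 k.+2)).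
have h3 := f_lower xt (x k.+2).
have h4 := dot_ge_enorm (grad f (x k.+2) + xi) (xt - x k.+2).
rewrite (enormB xt) in h1 h4; rewrite enormB -/(D k.+1) in h2.
have h5 : mu * breg h xt (x k.+2) <= mu * l * tau.
  rewrite -mulrA ler_wpM2l // (le_trans h1) // ler_wpM2l //.
  by rewrite (le_trans _ (ltW xk)) // expr2 ler_piMr // (le_trans (ltW xk)).
have h6 : M * breg h (x k.+1) (x k.+2) <= M * l * tau.
  rewrite -mulrA ler_wpM2l ?(ltW M0) // (le_trans h2) // ler_wpM2l //.
  by rewrite (le_trans _ (ltW D1)) // expr2 ler_piMr // (le_trans (ltW D1)).
have h7 : enorm (grad f (x k.+2) + xi) * enorm (x k.+2 - xt) <= 2 * c * tau.
  apply: (@le_trans _ _ (c * (D k.+1 + D k) * 1)).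
    by rewrite ler_pM ?enorm_ge0 // (le_trans (ltW xk)).
  by rewrite mulr1 (mulrC 2) -mulrA ler_wpM2l //; lra.
move: h3 h4; rewrite {2}/breg dotDl /real_merit /real_obj => h3 h4.
move: tauC; rewrite /C /b.
move: gxt h3 h4 h5 h6 h7.
by lra.
Qed.

(* By the mean value theorem [psi (E k - b) - psi (E k.+1 - b)] is
   [psi' s * (E k - E k.+1)] for an intermediate level [s], which is the level of
   some point [(x k.+2, w)] with [w] close to [x k.+2]; the KL inequality is used
   at that point, since [psi] need not be concave. *)
Lemma KL_step : exists (N : nat) (e c : R) (p : nat -> R),
  [/\ 0 < e, 0 <= c, forall k, (N <= k)%N -> 0 <= p k, p @ \oo --> 0 &
   forall k, (N <= k)%N -> enorm (x k.+2 - xt) < e ->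
     p k.+1 <= p k /\ Num.sqrt (E k - E k.+1) ^+ 2 <=
       c * (p k - p k.+1) * (Num.sqrt (E k - E k.+1) + Num.sqrt (E k.+1 - E k.+2))].
Proof.
have [b [PsiE meritE bE Eb]] := merit_limit.
have [_ [eta0 [U [psi [eta00 zbU psiP KL]]]]] := merit_KL.
have [B [l [c [l0 c0 xB lip sub]]]] := iterates_subgradient.
have [kap kap0 Dkap] := step_len_le.
have [psi0 psi_ge0 cpsi psi_diff] := psiP.
have [r r0 rU] := (nbhs_enormP _ U).1 zbU.
have M0 := M_gt0.
pose S k := Num.sqrt (E k - E k.+1).
have S0 k : 0 <= S k by exact: sqrtr_ge0.
have E_le k : E k.+1 <= E k by exact: merit_noninc.
have S2 k : S k ^+ 2 = E k - E k.+1 by rewrite sqr_sqrtr ?subr_ge0.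
pose cw := Num.sqrt (2 / sigma * (M^-1 + l * kap ^+ 2)).
have cw0 : 0 <= cw by exact: sqrtr_ge0.
(* Slope at [(x k.+2, w)]: the optimality residual plus the effect of moving the second variable to
   [w]. *)
pose cA := c * kap + 2 * M * l * cw.
have cA0 : 0 <= cA by rewrite addr_ge0 ?mulr_ge0 // ltW.
(* Two gaps below [q] keep [w] within [Num.min 1 (r / 4)] of [x k.+2]. *)
pose q := Num.min 1 (r / 4) / (2 * (cw + 1)).
have q0 : 0 < q by rewrite divr_gt0 ?lt_min ?ltr01 ?divr_gt0 // mulr_gt0 // ltr_wpDl.
have [N1 N1S] : exists N, forall k, (N <= k)%N -> S k < q.
  have /cvgrPdist_lt/(_ _ q0)[N _ NP] := merit_gap_cvg0.
  by exists N => k /NP; rewrite /= sub0r normrN ger0_norm.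
have [N2 N2E] : exists N, forall k, (N <= k)%N -> ((E k - b)%:E < eta0)%E.
  have [t [t0 tE]] : exists t : R, 0 < t /\ (t%:E <= eta0)%E.
    case: eta0 eta00 {KL psiP psi_ge0 psi_diff} => [t||] //; first by exists t.
    by exists 1; rewrite ltr01 leey.
  have /cvgrPdist_lt/(_ _ t0)[N _ NP] := Eb.
  exists N => k /NP /=; rewrite distrC ger0_norm ?subr_ge0 // => kt.
  by apply: lt_le_trans tE; rewrite lte_fin.
pose p k := psi (E k - b).
exists (N1 + N2)%N, (r / 4), (4 * cA), p; split.
- by rewrite divr_gt0.
- by rewrite mulr_ge0.
- move=> k Nk; apply: psi_ge0; first by rewrite subr_ge0.
  by apply: N2E; apply: leq_trans Nk; rewrite leq_addl.
- have /cvgrPdist_lt cps := cpsi.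
  apply/cvgrPdist_lt => e e0; have [e1 /= e10 He1] := cps _ e0.
  have /cvgrPdist_lt/(_ _ e10)[N _ NP] := Eb.
  exists N => // k /NP /=; rewrite distrC => kt.
  (* The right-hand limit of [psi] at 0 says nothing about the point 0 itself. *)
  have [Eb0|Eb0] := eqVneq (E k - b) 0; first by rewrite /p Eb0 psi0 subrr normr0.
  have := He1 (E k - b); rewrite /= sub0r normrN psi0 => /(_ kt); apply.
  by rewrite lt_def Eb0 subr_ge0 /=.
move=> k Nk xk.
have k1 : (N1 <= k)%N by apply: leq_trans Nk; rewrite leq_addr.
have k2 : (N2 <= k)%N by apply: leq_trans Nk; rewrite leq_addl.
rewrite -/(S k) -/(S k.+1).
have [EE|En] := eqVneq (E k) (E k.+1).
  by rewrite /p S2 EE !subrr mulr0 mul0r lexx.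
have Elt : E k.+1 < E k by rewrite lt_neqAle eq_sym En E_le.
have [s [s1 s2 psi's psiE]] := desingularizing_MVT psiP
  (ltac:(by rewrite subr_ge0) : 0 <= E k.+1 - b)
  (ltac:(by rewrite ltrD2r) : E k.+1 - b < E k - b) (N2E k k2).
(* In the zero space all iterates coincide, contradicting the strict decrease of [E]. *)
have [v v0] : exists v : 'rV[R]_d, v != 0.
  apply: contrapT => nov; have all0 (u w : 'rV[R]_d) : u = w.
    apply/eqP; rewrite -subr_eq0; apply/negPn/negP => uw; apply: nov; by exists (u - w).
  move/eqP: En; apply; rewrite /real_merit /real_obj.
  by rewrite (all0 (x k.+2) (x k.+1)) (all0 (x k) (x k.+1)).
(* The Bregman distance putting [(x k.+2, w)] at level [s + b]; it is nonnegative since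
   [s + b > E k.+1 >= real_obj k.+2]. *)
pose tau := (s + b - real_obj k.+2) / M.
have objE := obj_le_merit k.+1.
have tau0 : 0 <= tau.
  rewrite divr_ge0 ?(ltW M0) // subr_ge0 (le_trans objE) // -lerBlDr.
  exact: ltW.
have [w wE] := breg_level (x k.+2) h_C1 sigma_gt0 h_strongly_convex v0 tau0.
have Mtau : M * tau = s + b - real_obj k.+2 by rewrite mulrC divfK ?gt_eqF.
have xB2 j : enorm (x j) <= B + 2 by rewrite (le_trans (xB j)) // lerDl.
have hxx : breg h (x k.+1) (x k.+2) <= l * D k.+1 ^+ 2.
  rewrite /step_len enormB; apply: breg_le_lipschitz (h_C1.1 _) h_convex _.
  exact: lip.
have wx_le : enorm (w - x k.+2) <= cw * (S k + S k.+1).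
  have b1 := strongly_convex_breg w (h_C1.1 (x k.+2)) h_strongly_convex.
  rewrite wE in b1.
  apply: level_dist_le b1 _; rewrite ?enorm_ge0 //.
  have : M * breg h (x k.+1) (x k.+2) <= M * (l * (kap * S k.+1) ^+ 2).
    rewrite ler_wpM2l ?(ltW M0) // (le_trans hxx) // ler_wpM2l //.
    by rewrite ler_pXn2r ?nnegrE ?mulr_ge0 ?enorm_ge0 ?Dkap.
  (* As [s + b < E k], [M * tau] is at most [S k ^+ 2 + M * breg h (x k.+1) (x k.+2)]. *)
  rewrite -(lerD2l (S k ^+ 2)); apply: le_trans.
  have -> : S k ^+ 2 + M * breg h (x k.+1) (x k.+2) = E k - real_obj k.+2.
    by rewrite S2 {2}/real_merit; ring.
  by rewrite Mtau lerD2r -lerBrDr ltW.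
have qE : q * (2 * (cw + 1)) = Num.min 1 (r / 4).
  by rewrite divfK // gt_eqF // mulr_gt0 // ltr_wpDl.
have wx_small : enorm (w - x k.+2) < Num.min 1 (r / 4).
  apply: le_lt_trans wx_le _; rewrite -qE.
  apply: (le_lt_trans (ler_wpM2l cw0 (ltW (ltrD (N1S _ k1) (N1S _ (leqW k1)))))).
  rewrite -subr_gt0 (_ : _ - _ = q + q); first by rewrite addr_gt0.
  by ring.
move: wx_small; rewrite lt_min => /andP[wx1 wxr].
have wB : enorm w <= B + 1.
  rewrite -(subrK (x k.+2) w) (le_trans (enormD _ _)) // addrC lerD //.
  exact: ltW.
have z0U : nbhs (row_mx (x k.+2) w) U by exact: nbhs_row_mx rU xk wxr.
have [xi sub_xi xi_le] := sub k.
pose A := cA * (S k + S k.+1).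
have A0 : 0 <= A := mulr_ge0 cA0 (addr_ge0 (S0 _) (S0 _)).
have A_ge : enorm (grad f (x k.+2) + xi) + 2 * M * l * enorm (w - x k.+2) <= A.
  have a1 : c * (D k.+1 + D k) <= c * (kap * (S k + S k.+1)).
    by rewrite ler_wpM2l // mulrDr addrC lerD ?Dkap.
  have a2 : 2 * M * l * enorm (w - x k.+2) <= 2 * M * l * (cw * (S k + S k.+1)).
    by rewrite ler_wpM2l // !mulr_ge0 // ltW.
  have -> : A = c * (kap * (S k + S k.+1)) + 2 * M * l * (cw * (S k + S k.+1)).
    by rewrite /A /cA; ring.
  exact: lerD (le_trans xi_le a1) a2.
have z0E : merit f h g M (row_mx (x k.+2) w) = (s + b)%:E.
  by rewrite /merit row_mxKl row_mxKr obj_fin wE Mtau -EFinD subrKC.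
have xBB : enorm (x k.+2) <= B + 1 by rewrite (le_trans (xB _)) // lerDl.
have lip' u u' : enorm u <= B + 1 + 1 -> enorm u' <= B + 1 + 1 ->
    enorm (grad h u - grad h u') <= l * enorm (u - u').
  by rewrite -!addrA; exact: lip.
have C0 : 0 <= (mu + M) * l by rewrite mulr_ge0 ?addr_ge0 // ltW.
have bsb : b < s + b by rewrite ltrDr; apply: le_lt_trans s1; rewrite subr_ge0.
have seta : ((s + b - b)%:E < eta0)%E.
  by rewrite addrK; apply: lt_trans (N2E k k2); rewrite lte_fin.
have lF : lower_semicontinuous (merit f h g M) by exact: lower_semicontinuous_merit.
have F_gt z : (-oo < merit f h g M z)%E.
  rewrite /merit /Psi; have := g_proper.1 (lsubmx z).
  by case: (g _) => [y||] // _; rewrite ltNyr.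
have low z : enorm (z - row_mx (x k.+2) w) <= 1 ->
    ((s + b - A * enorm (z - row_mx (x k.+2) w) -
      (mu + M) * l * enorm (z - row_mx (x k.+2) w) ^+ 2)%:E <= merit f h g M z)%E.
  move=> z1; have := merit_lower_bound h_C1.1 h_convex mu_ge0 (ltW M0) l0 f_lower lip' sub_xi
    xBB wB A_ge z1.
  by rewrite wE Mtau -/(real_obj k.+2) (addrCA (real_obj _)) subrr addr0.
have := KL_slope lF F_gt psiP KL z0U meritE z0E bsb seta A0 C0 ltr01 low.
rewrite addrK => slope.
have dE : 0 < E k - E k.+1 by rewrite subr_gt0.
have pE : p k - p k.+1 = derive1 psi s * (E k - E k.+1).
  by rewrite /p psiE; congr (_ * _); ring.
split; first by rewrite -subr_ge0 pE mulr_ge0 ?ltW.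
rewrite S2 pE; move: slope; rewrite -(ler_pM2l dE) mulr1 /A => /le_trans; apply.
by rewrite le_eqVlt; apply/orP; left; apply/eqP; ring.
Qed.

(** Trapping works in every ball of radius [r <= e], so it gives convergence as well as summability.
    It is applied to the shifted sequence [x k.+1], whose steps [D k.+1] are bounded through
    [S k.+1]. *)
Lemma iterates_cvg : (forall r : R, 0 < r ->
    exists N, forall k, (N <= k)%N -> enorm (x k - xt) < r) /\
  exists (N : nat) (C : R), forall m, \sum_(i < m) D (N + i)%N <= C.
Proof.
have [N0 [e [c [p [e0 c0 p0 pcvg rec]]]]] := KL_step.
have [kap kap0 Dkap] := step_len_le.
pose S k := Num.sqrt (E k - E k.+1).
have trap r : 0 < r -> r <= e -> exists (N : nat) (B : R), (N0 <= N)%N /\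
    forall m, \sum_(i < m) S (N + i)%N <= B /\ enorm (x (N + m).+1 - xt) < r.
  move=> r0 re.
  apply: (@trapped_finite_length R d (fun k => x k.+1) xt S p c kap r N0) => //.
  - by move=> k _; exact: sqrtr_ge0.
  - by move=> k _; exact: Dkap.
  - exact: merit_gap_cvg0.
  - move=> q N q0; have [[//|j] jN jq] := iterates_frequently_near N.+1 q0.
    by exists j.
  - by move=> k Nk kr; apply: rec => //; exact: lt_le_trans re.
split.
  move=> r r0; have [||N [B [_ NB]]] := trap (Num.min r e).
  - by rewrite lt_min r0.
  - by rewrite ge_min lexx orbT.
  exists N.+1 => [[//|k]] Nk; have [_] := NB (k - N)%N.
  by rewrite subnKC // lt_min => /andP[].
have [N [B [_ NB]]] := trap e e0 (lexx e).
exists N, (kap * B) => m; apply: (@le_trans _ _ (kap * \sum_(i < m) S (N + i)%N)).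
  by rewrite mulr_sumr; apply: ler_sum => i _; exact: Dkap.
by rewrite ler_wpM2l //; have [] := NB m.
Qed.

(** The iterates are the approximating sequence: [grad f (x k.+2) + xi k] is a regular subgradient
    of [Psi] tending to 0 with the step lengths, and the objective converges because [E] does and
    its Bregman term vanishes. *)
Lemma limit_critical : critical (Psi f g) xt.
Proof.
have [b [PsiE _ bE Eb]] := merit_limit.
have [xcvg _] := iterates_cvg.
have [B [l [c [l0 c0 xB lip sub]]]] := iterates_subgradient.
have M0 := M_gt0.
have /choice[xi xiP] : forall k, exists xi : 'rV[R]_d,
    (forall u, ((fine (g (x k.+2)) + dot xi (u - x k.+2))%:E <= g u)%E) /\
    enorm (grad f (x k.+2) + xi) <= c * (D k.+1 + D k).
  by move=> k; have [xi] := sub k; exists xi.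
split; first by rewrite PsiE.
exists (fun k => x k.+2), (fun k => grad f (x k.+2) + xi k); split.
- apply: cvg_enorm => r /xcvg[N NP]; exists N => // k /= Nk.
  by apply: NP; rewrite (leq_trans Nk) // -addn2 leq_addr.
- under eq_fun do rewrite obj_fin.
  rewrite PsiE; apply: cvg_EFin; first by near=> k.
  apply/cvgrPdist_lt => e e0.
  have tau0 : 0 < Num.min 1 (e / 2 / (M * l + 1)).
    by rewrite lt_min ltr01 !divr_gt0 // ltr_wpDl // mulr_ge0 // ltW.
  have [N1 N1P] := step_len_cvg0 tau0.
  have e20 : 0 < e / 2 by rewrite divr_gt0.
  move/cvgrPdist_lt: Eb => /(_ _ e20)[N2 _ N2P].
  exists (N1 + N2)%N => // k /= Nk.
  have /N1P : (N1 <= k.+1)%N by rewrite (leq_trans _ (leqW Nk)) // leq_addr.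
  have /N2P /= : (N2 <= k.+1)%N by rewrite (leq_trans _ (leqW Nk)) // leq_addl.
  rewrite lt_min => kE /andP[D1 D2].
  have D0 : 0 <= D k.+1 by exact: enorm_ge0.
  have xB2 j : enorm (x j) <= B + 2 by have := xB j; lra.
  have h2 := breg_le_lipschitz (h_C1.1 (x k.+1)) h_convex (lip _ _ (xB2 k.+1) (xB2 k.+2)).
  rewrite enormB -/(D k.+1) in h2.
  have h3 : 0 <= M * breg h (x k.+1) (x k.+2) by rewrite mulr_ge0 ?h_breg_ge0 // ltW.
  have h4 : M * breg h (x k.+1) (x k.+2) <= M * (l * D k.+1).
    rewrite ler_wpM2l ?(ltW M0) // (le_trans h2) // ler_wpM2l //.
    by rewrite expr2 ler_piMr // ltW.
  have h5 : (M * l + 1) * D k.+1 < e / 2.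
    by move: D2; rewrite ltr_pdivlMr ?ltr_wpDl ?mulr_ge0 ?(ltW M0) // mulrC.
  move: kE; rewrite /real_merit !ltr_norml => /andP[k1 k2].
  move: h3 h4 h5 k1 k2 D0; set w := M * breg _ _ _ => h3 h4 h5 k1 k2 D0.
  by apply/andP; split; lra.
- move=> k; have [sub_xi _] := xiP k.
  apply: (@frechet_subdiff_quadratic _ _ _ _ _ (real_obj k.+2) (mu * l) 1) => //.
    exact: obj_fin.
  move=> u u1; apply: Psi_lower_bound => //.
  apply: breg_le_lipschitz (h_C1.1 _) h_convex _.
  apply: lip; last by have := xB k.+2; lra.
  by have := enormD (u - x k.+2) (x k.+2); rewrite subrK; have := xB k.+2; lra.
apply: cvg_enorm => e e0.
have tau0 : 0 < e / (2 * c + 1) by rewrite divr_gt0 // ltr_wpDl // mulr_ge0.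
have [N NP] := step_len_cvg0 tau0.
exists N => // k /= Nk; rewrite subr0; have [_ xi_le] := xiP k.
apply: le_lt_trans xi_le _.
have := NP _ Nk; have := NP _ (leqW Nk).
rewrite !ltr_pdivlMr ?ltr_wpDl ?mulr_ge0 // => d1 d2.
have [s1 s2] : 0 <= D k.+1 /\ 0 <= D k by rewrite !enorm_ge0.
by lra.
Unshelve. all: by end_near. Qed.

Lemma finite_length : (\sum_(1 <= k <oo) (enorm (x k - x k.-1))%:E < +oo)%E.
Proof.
have [_ [N [C NC]]] := iterates_cvg.
have ge0 k : (0 <= (enorm (x k - x k.-1))%:E)%E by rewrite lee_fin enorm_ge0.
apply: (@le_lt_trans _ _ (\sum_(1 <= k < N.+1) enorm (x k - x k.-1) + C)%:E); last exact: ltry.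
apply: lime_le; first by apply: is_cvg_nneseries => k _ _; exact: ge0.
apply: nearW => n.
(* Raising the upper index only increases the sum; its part from [N.+1] on consists of the [n]
   lengths [D (N + i)]. *)
apply: (@le_trans _ _ (\sum_(1 <= k < N.+1 + n) (enorm (x k - x k.-1))%:E)%E).
  by apply: (ereal_nondecreasing_series (fun k _ _ => ge0 k)); rewrite leq_addl.
rewrite sumEFin lee_fin (@big_cat_nat _ _ _ N.+1) //=; last by rewrite leq_addr.
rewrite lerD2l -{1}(add0n N.+1) (addnC N.+1) big_addn addnK big_mkord.
by rewrite (le_trans _ (NC n)) // ler_sum // => i _; rewrite addnS /= addnC.
Qed.

Lemma bpge_convergence :
  (\sum_(1 <= k <oo) (enorm (x k - x k.-1))%:E < +oo)%E /\
  (x @ \oo --> xt /\ critical (Psi f g) xt).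
Proof.
split; first exact: finite_length.
split; last exact: limit_critical.
by apply: cvg_enorm => r /iterates_cvg.1[N NP]; exists N.
Qed.

End Convergence.

Theorem theorem2 (R : realType) (d : nat)
  (f h : 'rV[R]_d -> R) (g : 'rV[R]_d -> \bar R)
  (L mu : R) (eta betahat rho : R) (lam : nat -> R) (M sigma : R)
  (x : nat -> 'rV[R]_d) (xt : 'rV[R]_d)
  (f_C1 : C1 f)
  (g_proper : eproper g) (g_lsc : lower_semicontinuous g) (g_convex : econvex g)
  (Psi_bounded : (-oo < ereal_inf (range (Psi f g)))%E)
  (h_C1 : C1 h) (h_convex : convex_function setT h)
  (L_gt0 : 0 < L)
  (Lsmad_sub : convex_function setT (fun u => L * h u - f u))
  (Lsmad_add : convex_function setT (fun u => L * h u + f u))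
  (mu_ge0 : 0 <= mu) (mu_leL : mu <= L)
  (f_weakly_convex : convex_function setT (fun u => f u + mu * h u))
  (Psi_supercoercive : supercoercive (Psi f g))
  (h_strictly_convex : strictly_convex h)
  (breg_cvg0 : forall (u : nat -> 'rV[R]_d) (a : 'rV[R]_d),
     u @ \oo --> a -> breg h a (u k) @[k --> \oo] --> (0 : R))
  (breg_cvg : forall (u v : nat -> 'rV[R]_d) (a : 'rV[R]_d),
     v @ \oo --> a -> bounded_set (range u) ->
     breg h (u k) (v k) @[k --> \oo] --> (0 : R) -> u @ \oo --> a)
  (eta_gt0 : 0 < eta) (eta_lt1 : eta < 1)
  (betahat_ge0 : 0 <= betahat) (betahat_lt1 : betahat < 1)
  (rho_gt0 : 0 < rho) (rho_lt1 : rho < 1)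
  (lam_gt0 : forall k, 0 < lam k) (lam_le : forall k, lam k <= L^-1)
  (inf_lam_gt0 : 0 < inf (range lam))
  (rho_lt : rho < inf (range lam) / sup (range lam))
  (M_gt : rho * (inf (range lam))^-1 < M) (M_le : M <= (sup (range lam))^-1)
  (x_BPGe : is_BPGe f h g mu eta betahat rho lam x)
  (sigma_gt0 : 0 < sigma) (h_strongly_convex : strongly_convex sigma h)
  (grad_h_lipschitz : forall B : set 'rV[R]_d, bounded_set B ->
     [lipschitz grad h u | u in B])
  (grad_f_lipschitz : forall B : set 'rV[R]_d, bounded_set B ->
     [lipschitz grad f u | u in B])
  (clarke_bounded : forall B : set 'rV[R]_d, bounded_set B ->
     exists delta : R, 0 < delta /\
       forall a, B a -> exists A, clarke_jacobian (grad h) a A /\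
         opnorm A <= delta)
  (xt_limit_point :
     cluster (row_mx (x k) (x k.-1) @[k --> \oo]) (row_mx xt xt))
  (merit_KL : KL_at (merit f h g M) (row_mx xt xt)) :
  (\sum_(1 <= k <oo) (enorm (x k - x k.-1))%:E < +oo)%E /\
  (x @ \oo --> xt /\ critical (Psi f g) xt).
Proof.
have [f_diff _] := f_C1; have [h_diff _] := h_C1.
have f_upper u v : breg f u v <= L * breg h u v.
  have := @breg_combination_ge0 R d h f L (-1) u v (h_diff v) (f_diff v).
  under eq_fun do rewrite mulN1r.
  by move=> /(_ Lsmad_sub); rewrite mulN1r subr_ge0.
have f_lower u v : - mu * breg h u v <= breg f u v.
  have := @breg_combination_ge0 R d f h 1 mu u v (f_diff v) (h_diff v).
  under eq_fun do rewrite mul1r.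
  by move=> /(_ f_weakly_convex); lra.
have eta01 : 0 <= eta <= 1 by rewrite !ltW.
have betahat01 : 0 <= betahat <= 1 by rewrite betahat_ge0 ltW.
by apply: (@bpge_convergence R d f h g L mu eta betahat rho lam M sigma x xt);
  assumption.
Qed.
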